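(* There exists a polynomial time algorithm which, given as input any finite simple directed graph $G$ with positive minimum in-degree, outputs a strict majority dynamic monopoly of $G$ of cardinality at most $|G|/2$.
   Context: A directed graph is simple if it has no loops and there is at most one edge between any two vertices (in particular there is no directed cycle of length two). $|G|$ denotes the number of vertices of $G$, and $\deg^{in}(v)$ the in-degree of $v$. Given a directed graph $G$ and a threshold assignment $\tau:V(G)\to\mathbb{N}$, a subset $M\subseteq V(G)$ is a dynamic monopoly for $(G,\tau)$ if $V(G)$ can be partitioned as $D_0\cup D_1\cup\dots\cup D_t$ with $D_0=M$ such that for every $i\ge 1$ and every $v\in D_i$, the number of edges from $D_0\cup\dots\cup D_{i-1}$ to $v$ is at least $\tau(v)$. A strict majority dynamic monopoly of $G$ is a dynamic monopoly for $(G,\tau)$ with $\tau(v)=\lceil (\deg^{in}(v)+1)/2\rceil$ for every vertex $v$. *)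

(* Defs.v *)
From HB Require Import structures.
From mathcomp Require Import all_boot all_order all_algebra.

Set Implicit Arguments.
Unset Strict Implicit.
Unset Printing Implicit Defensive.

(** * Directed graphs

A directed graph on the finite vertex type [T] is its edge relation: [e u v]
means that there is an edge from [u] to [v].  Parallel edges are thus excluded
by the representation. *)

Section Digraph.
Variables (T : finType) (e : rel T).

Definition simple_digraph : Prop :=
  irreflexive e /\ (forall u v : T, e u v -> ~~ e v u).

Definition indeg (v : T) : nat := #|[set u | e u v]|.

(** The classes [D i] are allowed to be empty.  As there are no parallel edges,
the number of edges from a set [A] to [v] is the number of [u] in [A] with
[e u v]. *)
Definition dynamic_monopoly (tau : T -> nat) (M : {set T}) : Prop :=
  exists (t : nat) (D : 'I_t.+1 -> {set T}),
    [/\ D ord0 = M,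
        \bigcup_(i < t.+1) D i = [set: T],
        (forall i j : 'I_t.+1, i != j -> [disjoint D i & D j])
      & forall (i : 'I_t.+1) (v : T), 0 < i -> v \in D i ->
          tau v <= #|[set u in \bigcup_(j < t.+1 | j < i) D j | e u v]| ].

(** [uphalf m] is the ceiling of [m / 2]. *)
Definition strict_majority (v : T) : nat := uphalf (indeg v).+1.

Definition strict_majority_dynamo (M : {set T}) : Prop :=
  dynamic_monopoly strict_majority M.

End Digraph.

(** * Random access machines

The instruction set is that of Cook and Reckhow (Time bounded random access
machines, 1973), over natural numbers with truncated subtraction.  Since there
is no multiplication, each step lengthens the largest number in memory by at
most one bit, so that the number of steps (unit cost) is polynomially related to the
running time on a Turing machine. *)

Inductive instr : Type :=
| RConst of nat & nat         (* RConst i c   : X_i <- c               *)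
| RAdd of nat & nat & nat     (* RAdd i j k   : X_i <- X_j + X_k       *)
| RSub of nat & nat & nat     (* RSub i j k   : X_i <- X_j - X_k       *)
| RLoad of nat & nat          (* RLoad i j    : X_i <- X_(X_j)         *)
| RStore of nat & nat         (* RStore i j   : X_(X_i) <- X_j         *)
| RJump of nat & nat          (* RJump l j    : if X_j > 0 then goto l *)
| RRead of nat                (* RRead i      : X_i <- next input, 0 if none left *)
| RPrint of nat.              (* RPrint i     : append X_i to the output *)

Definition program := seq instr.

Record config : Type := Config {
  pc : nat;
  reg : nat -> nat;
  input : seq nat;
  output : seq nat }.

Definition upd (X : nat -> nat) (i c : nat) : nat -> nat :=
  fun k => if k == i then c else X k.

Definition exec (a : instr) (s : config) : config :=
  let: Config l X x y := s in
  match a with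
  | RConst i c => Config l.+1 (upd X i c) x y
  | RAdd i j k => Config l.+1 (upd X i (X j + X k)) x y
  | RSub i j k => Config l.+1 (upd X i (X j - X k)) x y
  | RLoad i j => Config l.+1 (upd X i (X (X j))) x y
  | RStore i j => Config l.+1 (upd X (X i) (X j)) x y
  | RJump m j => Config (if 0 < X j then m else l.+1) X x y
  | RRead i => Config l.+1 (upd X i (head 0 x)) (behead x) y
  | RPrint i => Config l.+1 X x (rcons y (X i))
  end.

(** The machine halts when the program counter leaves the program; a halted
configuration is a fixed point of [step]. *)
Definition halted (P : program) (s : config) : bool := size P <= pc s.

Definition step (P : program) (s : config) : config :=
  if onth P (pc s) is Some a then exec a s else s.

Definition init (x : seq nat) : config := Config 0 (fun=> 0) x [::].

(** Started on the input [x], [P] halts after at most [t] steps, having printed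
[y]. *)
Definition outputs_within (P : program) (x : seq nat) (t : nat) (y : seq nat)
    : Prop :=
  let s := iter t (step P) (init x) in halted P s /\ output s = y.

(** * Representation of graphs and vertex sets

A graph is given by its number of vertices followed by its adjacency matrix in
row-major order, a vertex set by its characteristic vector. *)

Definition digraph_code (T : finType) (e : rel T) : seq nat :=
  #|T| :: [seq nat_of_bool (e u v) | u <- enum T, v <- enum T].

Definition vset_code (T : finType) (M : {set T}) : seq nat :=
  [seq nat_of_bool (v \in M) | v <- enum T].

(* Main.v *)
Require Import Defs.
From HB Require Import structures.
From mathcomp Require Import all_boot all_order all_algebra.
From mathcomp Require Import zify.

Set Implicit Arguments.
Unset Strict Implicit.
Unset Printing Implicit Defensive.

(** Call a nonempty set X blocking if each x in X has at least half of its
in-neighbours in X.  A set meeting all blocking sets is a strict majority dynamic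
monopoly, so it suffices to split the vertices into two classes neither of which
contains a blocking set: the smaller class is the answer.

Vertices are coloured one at a time.  A vertex t can take a colour carried by fewer
than half of its in-neighbours.  If there is none, t is balanced, and the hole can
be moved to any in-neighbour u of t: t takes the colour of u and u becomes the
uncoloured vertex.  The hole is moved until it reaches an unbalanced vertex.

Let the hole be at r and let p be an in-neighbour of r.  If some in-neighbour q of
p is not reachable from r without passing through p, move the hole to p and replace
(p, r) by (q, p); the set reachable from r without passing through p grows, so this
stops.  Otherwise let Z be the cycle formed by the edge from p to r and a shortest
path from r to p.  Moving the hole around Z rotates the colours of Z; since only
one in-neighbour of p lies on Z, the hole can stay balanced at p only if Z is
monochromatic.  Then move the hole from p to an in-neighbour q of the other colour
and along a path back to Z.  Now p has brought the other colour onto Z, which has at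
least three vertices because there are no 2-cycles, so Z is no longer monochromatic
and the hole disappears during the next rotations. *)

(** * Moving an uncoloured vertex *)

Lemma count_lt (T : eqType) (a b : pred T) (s : seq T) x :
  subpred a b -> x \in s -> b x -> ~~ a x -> count a s < count b s.
Proof.
move=> sub_ab; elim: s => //= y s IHs; rewrite inE => /predU1P[<- bx nax|].
  by rewrite bx (negbTE nax) ltnS sub_count.
move=> xs bx nax; have := IHs xs bx nax; have := sub_ab y.
by case: (a y) => [->|] // _; case: (b y); lia.
Qed.

Section Token.
Variables (n : nat) (E : rel nat).
Hypothesis E_lt : forall u v, E u v -> (u < n) && (v < n).
Hypothesis E_asym : forall u v, E u v -> ~~ E v u.

Let E_ltl u v : E u v -> u < n. Proof. by case/E_lt/andP. Qed.
Let E_ltr u v : E u v -> v < n. Proof. by case/E_lt/andP. Qed.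

Lemma E_neq u v : E u v -> u != v.
Proof.
by apply: contraTneq => ->; apply/negP => Evv; have := E_asym Evv; rewrite Evv.
Qed.

Definition deg (v : nat) : nat := count (E^~ v) (iota 0 n).

Definition cnt (c : nat) (col : nat -> nat) (v : nat) : nat :=
  count (fun u => E u v && (col u == c)) (iota 0 n).

(* Colour 0 means uncoloured.  A set X violating the conclusion would never be
   entered by an activation that starts outside X. *)
Definition valid (col : nat -> nat) : Prop :=
  forall c (X : pred nat), 0 < c -> (forall x, X x -> x < n /\ col x = c) ->
    (exists x, X x) ->
    exists2 x, X x & 2 * count (fun u => E u x && X u) (iota 0 n) < deg x.

Record token : Type := Token { col : nat -> nat; pos : nat; live : bool }.

(* The token t becomes live when both colours could close a blocking set; then
   each colour occurs on exactly half of its in-neighbours. *)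
Definition settle (f : nat -> nat) (t : nat) : token :=
  if 2 * cnt 1 f t < deg t then Token (upd f t 1) t false else
  if 2 * cnt 2 f t < deg t then Token (upd f t 2) t false else
  Token f t true.

(** Once the hole is filled nothing changes any more, so every phase can be repeated a fixed number
    of times without testing whether the hole still exists. *)
Definition move (u : nat) (k : token) : token :=
  if live k then settle (upd (upd (col k) (pos k) (col k u)) u 0) u else k.

(** [U] stands for the vertices treated so far, including the hole; it stays fixed while the hole
    moves. *)
Record inv (U : pred nat) (k : token) : Prop := Inv {
  inv_valid : valid (col k);
  inv_le2 : forall u, u < n -> col k u <= 2;
  inv_col : forall u, u < n ->
    (col k u == 0) = ~~ U u || (live k && (u == pos k));
  inv_live : live k -> [/\ pos k < n, U (pos k),
    2 * cnt 1 (col k) (pos k) = deg (pos k)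
    & 2 * cnt 2 (col k) (pos k) = deg (pos k)] }.

Lemma cnt_sum f v : (forall u, u < n -> f u <= 2) ->
  cnt 0 f v + cnt 1 f v + cnt 2 f v = deg v.
Proof.
move=> le2; rewrite /cnt /deg.
have: all (fun u => f u <= 2) (iota 0 n).
  by apply/allP => u; rewrite mem_iota => /le2.
elim: (iota 0 n) => //= u s IHs /andP[le2u /IHs].
by case: (E u v) => /=; case: (f u) le2u => [|[|[|]]] //= _; lia.
Qed.

Lemma cnt_gt0 c f u v : E u v -> f u = c -> 0 < cnt c f v.
Proof.
move=> Euv fu; rewrite /cnt -has_count; apply/hasP; exists u.
  by rewrite mem_iota (E_ltl Euv).
by rewrite Euv fu eqxx.
Qed.

Lemma deg_pos u v : E u v -> 0 < deg v.
Proof.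
move=> Euv; rewrite /deg -has_count; apply/hasP; exists u => //.
by rewrite mem_iota (E_ltl Euv).
Qed.

(** If [X] contains [t], then [t] is the witness: the in-neighbours of [t] in [X] already had colour
    [c] before the change. If [X] avoids [t], it was monochromatic before. *)
Lemma valid_upd f t c :
  valid f -> 0 < c -> 2 * cnt c f t < deg t -> valid (upd f t c).
Proof.
move=> vf c_gt0 lt_t d X d_gt0 Xd exX.
case Xt: (X t).
  exists t => //; apply: leq_ltn_trans lt_t; rewrite leq_mul2l /=.
  have dc : d = c by have [_] := Xd t Xt; rewrite /upd eqxx.
  apply: sub_count => u /= /andP[Eut Xu]; rewrite Eut /=.
  by have [_] := Xd u Xu; rewrite /upd (negbTE (E_neq Eut)) dc => ->.
apply: (vf d) => // x Xx; have [ltx] := Xd x Xx; rewrite /upd.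
by case: eqP => // eqx; rewrite eqx Xt in Xx.
Qed.

(* The neighbour u leaves the class that t enters, so t has one in-neighbour of its
   new colour fewer than the half it had before. *)
Lemma valid_shift f t u : valid f -> E u t -> 0 < f u ->
  2 * cnt (f u) f t = deg t -> valid (upd (upd f t (f u)) u 0).
Proof.
move=> vf Eut fu_gt0 bal d X d_gt0 Xd exX.
have Xu : ~~ X u.
  apply/negP => Xu; have [_] := Xd u Xu.
  by rewrite /upd eqxx => d0; rewrite -d0 in d_gt0.
case Xt: (X t).
  exists t => //; rewrite -bal ltn_mul2l /=.
  have dc : d = f u.
    by have [_] := Xd t Xt; rewrite /upd eq_sym (negbTE (E_neq Eut)) eqxx.
  apply: (@count_lt _ _ _ _ u) => [w /= /andP[Ewt Xw]|||].
  - rewrite Ewt; have [_] := Xd w Xw; rewrite /upd.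
    case: eqP => [eqw|_]; first by rewrite eqw (negbTE Xu) in Xw.
    by rewrite (negbTE (E_neq Ewt)) dc => ->; rewrite /=.
  - by rewrite mem_iota (E_ltl Eut).
  - by rewrite Eut eqxx.
  - by rewrite (negbTE Xu) andbF.
apply: (vf d) => // x Xx; have [ltx] := Xd x Xx; rewrite /upd.
case: eqP => [eqx|_]; first by rewrite eqx (negbTE Xu) in Xx.
by case: eqP => // eqx; rewrite eqx Xt in Xx.
Qed.

Lemma settle_inv U f t :
  valid f -> (forall u, u < n -> f u <= 2) ->
  (forall u, u < n -> (f u == 0) = ~~ U u || (u == t)) -> t < n -> U t ->
  inv U (settle f t).
Proof.
move=> vf le2 f0 ltt Ut; rewrite /settle.
have dead c : 0 < c <= 2 -> 2 * cnt c f t < deg t ->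
    inv U (Token (upd f t c) t false).
  case/andP=> c_gt0 c_le2 lt_t; split=> //=; first exact: valid_upd.
    by move=> u ltu; rewrite /upd; case: eqP => // _; apply: le2.
  move=> u ltu; rewrite orbF /upd; have := f0 u ltu.
  by case: (eqVneq u t) => [-> _|_ ->]; rewrite ?orbF // Ut -leqn0 leqNgt c_gt0.
case: ltnP => [|ge1]; first exact: dead.
case: ltnP => [|ge2]; first exact: dead.
(* Each colour takes at least half of the in-neighbours and both together at most all of them, so
   each takes exactly half. *)
split=> //= _; have := cnt_sum t le2.
by split=> //; lia.
Qed.

Lemma live_settle f t : live (settle f t) -> settle f t = Token f t true.
Proof. by rewrite /settle; case: ifP => // _; case: ifP. Qed.

Lemma live_col U k u : inv U k -> live k -> E u (pos k) -> 0 < col k u.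
Proof.
move=> kI lk Eu; rewrite lt0n; apply/eqP => col0.
have [_ _] := inv_live kI lk; have := cnt_sum (pos k) (inv_le2 kI).
by have := cnt_gt0 Eu col0; lia.
Qed.

Lemma live_has_col U k u c : inv U k -> live k -> E u (pos k) -> 0 < c <= 2 ->
  exists2 w, E w (pos k) & col k w = c.
Proof.
move=> kI lk Eu c12; have [_ _ c1 c2] := inv_live kI lk.
have : 0 < cnt c (col k) (pos k).
  have := deg_pos Eu; case: c c12 => [|[|[|]]] // _; lia.
rewrite /cnt -has_count => /hasP[w _ /andP[Ew /eqP wc]]; by exists w.
Qed.

Lemma move_inv U k u : inv U k -> (live k -> E u (pos k)) -> inv U (move u k).
Proof.
move=> kI; rewrite /move; case: ifP => // lk /(_ isT) Eu.
have [ltt Ut b1 b2] := inv_live kI lk; have col_u := live_col kI lk Eu.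
have ltu := E_ltl Eu; have := inv_le2 kI ltu; have neq := E_neq Eu.
have Uu : U u.
  have := inv_col kI ltu; rewrite (negbTE neq) andbF orbF eqn0Ngt col_u.
  by move/esym/negbFE.
move=> le2u; apply: settle_inv => //.
- apply: valid_shift => //; first exact: inv_valid kI.
  by case: (col k u) col_u le2u => [|[|[|]]].
- move=> w ltw; rewrite /upd; case: eqP => // _; case: eqP => // _.
  exact: inv_le2 kI w ltw.
- move=> w ltw; rewrite /upd; case: (eqVneq w u) => [_|_]; first by rewrite orbT.
  rewrite orbF; case: (eqVneq w (pos k)) => [->|nwt].
    by rewrite Ut eqn0Ngt col_u.
  by rewrite (inv_col kI ltw) (negbTE nwt) andbF orbF.
Qed.

Lemma live_move u k : live (move u k) -> [/\ live k,
  pos (move u k) = u & col (move u k) = upd (upd (col k) (pos k) (col k u)) u 0].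
Proof. by rewrite /move; case: ifP => [lk /live_settle ->|->]. Qed.

(** * Rotating the colours of a cycle *)

Section Rotation.
Variables (p r : nat) (D P : nat -> nat).

(* D is the breadth-first level, starting from 1 at r, in the graph obtained by
   deleting the edges leaving p; D = 0 on vertices that are not reached. *)
Record bfs : Prop := Bfs {
  bfs_root : D r = 1;
  bfs_lt : forall y, 0 < D y -> y < n;
  bfs_le : forall y, D y <= n;
  bfs_parent : forall y, 0 < D y -> y != r ->
    [/\ E (P y) y, P y != p, 0 < D (P y) & D y = (D (P y)).+1];
  bfs_edge : forall x y, E x y -> x != p -> 0 < D x -> 0 < D y <= (D x).+1 }.

Hypothesis pr_bfs : bfs.
Hypothesis E_pr : E p r.

(** Levels are at most [n], so from a reached vertex [n] rounds suffice to bring a live token to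
    [r], where it then waits. *)
Definition descend (k : token) : token :=
  iter n (fun k => if pos k == r then k else move (P (pos k)) k) k.

Definition rotate (k : token) : token := move p (descend k).

Lemma D_eq1 y : 0 < D y -> (D y == 1) = (y == r).
Proof.
move=> Dy; apply/eqP/eqP => [Dy1|->]; last exact: bfs_root.
apply/eqP; apply: contraT => nyr.
by have [_ _ ? Dyq] := bfs_parent pr_bfs Dy nyr; lia.
Qed.

Lemma D_iter y i : i < D y -> D (iter i P y) = D y - i.
Proof.
elim: i => [|i IHi] lti; first by rewrite subn0.
have Dy := IHi (ltnW lti); rewrite iterS.
have Di : 0 < D (iter i P y) by rewrite Dy; lia.
have nr : iter i P y != r by rewrite -D_eq1 // Dy; lia.
by have [_ _ _] := bfs_parent pr_bfs Di nr; lia.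
Qed.

Lemma iter_root y : 0 < D y -> iter (D y).-1 P y = r.
Proof.
by move=> Dy; apply/eqP; rewrite -D_eq1 D_iter; lia.
Qed.

(** Each vertex that the hole quits receives the colour of its parent, so the colours shift by one
    along the path to [r]. Levels drop along this path, hence it is simple and every colour is read
    before it is overwritten. *)
Lemma descend_spec U k : inv U k -> (live k -> 0 < D (pos k)) ->
  inv U (descend k) /\
  (live (descend k) -> [/\ live k, pos (descend k) = r &
     forall y, y != r -> col (descend k) y =
       if y \in traject P (pos k) (D (pos k)).-1 then col k (P y)
       else col k y]).
Proof.
move=> kI Dk; set y0 := pos k.
pose step (k : token) := if pos k == r then k else move (P (pos k)) k.
(* The minimum accounts for the rounds that the token spends waiting at [r]. *)
suff main j : inv U (iter j step k) /\
    (live (iter j step k) -> live k /\ let i := minn j (D y0).-1 in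
     pos (iter j step k) = iter i P y0 /\
     forall y, col (iter j step k) y =
       if y == iter i P y0 then 0 else
       if y \in traject P y0 i then col k (P y) else col k y).
  have [dI dL] := main n; split=> // /dL[lk]; have := bfs_le pr_bfs y0.
  have := Dk lk; rewrite -/y0 => D0 Dn.
  have -> /= : minn n (D y0).-1 = (D y0).-1 by lia.
  rewrite iter_root // => // -[posr colE]; split=> // y nyr.
  by rewrite /descend -/step colE (negbTE nyr).
elim: j => [|j [jI jL]] /=.
  split=> // lk; split=> //; rewrite min0n; split=> // y /=.
  case: eqP => // ->; have [ltp _ _ _] := inv_live kI lk.
  by have := inv_col kI ltp; rewrite lk eqxx orbT => /eqP.
have lp l : l = iter j step k -> live l -> pos l != r -> E (P (pos l)) (pos l).
  move=> -> ll nr; have [lk [posE _]] := jL ll.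
  have Dpos : 0 < D (pos (iter j step k)).
    by rewrite posE D_iter; have := Dk lk; rewrite -/y0; lia.
  by have [] := bfs_parent pr_bfs Dpos nr.
set l := iter j step k in jI jL lp *; rewrite /step.
case: (eqVneq (pos l) r) => [posr|nr].
  split=> // ll; have [lk [posE colE]] := jL ll; split=> //.
  have D0 := Dk lk; rewrite -/y0 in D0.
  suff -> : minn j.+1 (D y0).-1 = minn j (D y0).-1 by [].
  have : D (pos l) = 1 by rewrite posr; apply: bfs_root.
  by rewrite posE D_iter; lia.
split; first by apply: move_inv => // ll; exact: lp.
move=> lm; have [ll -> ->] := live_move lm; have [lk [posE colE]] := jL ll.
have D0 := Dk lk; rewrite -/y0 in D0.
split=> //; set i := minn j _ in posE colE *.
have ltj : j < (D y0).-1.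
  move: nr; rewrite ltnNge; apply: contraNN => le; apply/eqP.
  rewrite posE /i; have -> : minn j (D y0).-1 = (D y0).-1 by lia.
  exact: iter_root.
have -> : minn j.+1 (D y0).-1 = i.+1 by lia.
rewrite iterS -posE; split=> // y; rewrite /upd.
case: (eqVneq y (P (pos l))) => // nyP.
have PE : P (pos l) = iter i.+1 P y0 by rewrite posE.
have iE : i = j by lia.
rewrite trajectSr mem_rcons inE -posE; case: (eqVneq y (pos l)) => [->|ny] /=.
  (* Levels separate the vertices of the path, so the parent is neither the hole nor a vertex
     already passed. *)
  rewrite colE PE; case: eqP => [eqi|_].
    by have := congr1 D eqi; rewrite !D_iter; lia.
  case: trajectP => // -[h lth eqh].
  by have := congr1 D eqh; rewrite !D_iter; lia.
by rewrite colE -posE (negbTE ny).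
Qed.

Hypothesis in_reached : forall q, E q p -> 0 < D q.
Hypothesis in_p : exists q, E q p.

Let z i := iter i P p.

Lemma p_neq_r : p != r. Proof. exact: E_neq. Qed.

Lemma Dp_gt0 : 0 < D p.
Proof.
have [q Eqp] := in_p; have := bfs_edge pr_bfs Eqp (E_neq Eqp) (in_reached Eqp).
by case/andP.
Qed.

Lemma E_Pp : E (P p) p.
Proof. by have [] := bfs_parent pr_bfs Dp_gt0 p_neq_r. Qed.

Lemma Pp_neq_r : P p != r.
Proof. by apply: contraTneq E_Pp => ->; apply: E_asym. Qed.

(* Asymmetry excludes a cycle p -> r -> p. *)
Lemma Dp_gt2 : 2 < D p.
Proof.
have [_ _ DP ->] := bfs_parent pr_bfs Dp_gt0 p_neq_r.
by have := D_eq1 DP; rewrite (negbTE Pp_neq_r) => /eqP; lia.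
Qed.

Lemma z_last : z (D p).-1 = r. Proof. exact/iter_root/Dp_gt0. Qed.

Lemma z_inj i j : i < D p -> j < D p -> z i = z j -> i = j.
Proof. by move=> lti ltj /(congr1 D); rewrite !D_iter //; lia. Qed.

(** A shortest path has no shortcut: an edge from [z i] to [p] gives [D p <= (D p - i).+1]. *)
Lemma in_nbr_z i : 0 < i < D p -> E (z i) p -> i = 1.
Proof.
move=> /andP[i_gt0 lti] Ezp.
have := bfs_edge pr_bfs Ezp (E_neq Ezp); rewrite /z D_iter //; lia.
Qed.

(** Apart from [P p], no in-neighbour of [p] lies on the cycle, by [in_nbr_z] and by asymmetry at
    [r]. As [p] is balanced before and after the rotation, [P p] must keep its colour too. *)
Lemma rotate_from_p U k : inv U k -> (live k -> pos k = p) ->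
  inv U (rotate k) /\
  (live (rotate k) -> [/\ live k, pos (rotate k) = p,
    forall i, 0 < i < (D p).-1 -> col (rotate k) (z i) = col k (z i.+1),
    col (rotate k) r = col k (P p)
    & col (rotate k) (P p) = col k (P p)]).
Proof.
move=> kI posk; have Dp := Dp_gt2.
have [|dI dL] := descend_spec kI; first by move=> /posk ->; apply: Dp_gt0.
have rI : inv U (rotate k).
  by apply: move_inv => // /dL[_ -> _].
split=> // lr; have [ld posr colr] := live_move lr; have [lk posd cold] := dL ld.
rewrite (posk lk) posd in cold colr.
have colP : col (rotate k) r = col k (P p).
  rewrite colr /upd eq_sym (negbTE p_neq_r) eqxx (cold _ p_neq_r).
  by rewrite -[(D p).-1]prednK ?inE ?eqxx //; lia.
have colz i : 0 < i < (D p).-1 -> col (rotate k) (z i) = col k (z i.+1).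
  move=> /andP[i_gt0 lti]; rewrite colr /upd.
  case: eqP => [/(@z_inj i 0)|_]; first lia.
  case: eqP => [|/eqP nr]; first by rewrite -z_last => /z_inj; lia.
  by rewrite cold //; case: trajectP => // -[]; exists i.
split=> //; apply: contraTeq isT => nP.
have col_eq u : E u p -> u != P p -> col (rotate k) u = col k u.
  move=> Eup nuP; have nur : u != r.
    by apply: contraTneq Eup => ->; apply: E_asym.
  rewrite colr /upd (negbTE (E_neq Eup)) (negbTE nur) cold //.
  case: trajectP => // -[i lti uE]; rewrite uE in Eup nuP nur.
  have i_gt0 : 0 < i by case: i {lti uE nuP nur} Eup => // /E_neq; rewrite eqxx.
  by have i1 := @in_nbr_z i _ Eup; rewrite i1 ?eqxx // in nuP; lia.
(* If [P p] lost the colour [c], the count of [c] around [p] would drop strictly, while balance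
   makes it half of the in-degree both times. *)
set c := col k (P p).
have := @count_lt _ (fun u => E u p && (col (rotate k) u == c))
  (fun u => E u p && (col k u == c)) (iota 0 n) (P p).
rewrite -/(cnt c (col (rotate k)) p) -/(cnt c (col k) p).
have [_ _ b1 b2] := inv_live rI lr; rewrite posr in b1 b2.
have [_ _ b1' b2'] := inv_live kI lk; rewrite (posk lk) in b1' b2'.
have c_gt0 : 0 < c by apply: (live_col kI lk); rewrite (posk lk) E_Pp.
have := inv_le2 kI (E_ltl E_Pp); rewrite -/c.
move=> c_le2 lt_cnt; suff : cnt c (col (rotate k)) p < cnt c (col k) p.
  by case: (c) c_gt0 c_le2 => [|[|[|]]] //; lia.
apply: lt_cnt => [u /andP[Eup]|||].
- rewrite Eup; case: (eqVneq u (P p)) => [->|nu]; first by rewrite (negbTE nP).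
  by rewrite col_eq.
- by rewrite mem_iota (E_ltl E_Pp).
- by rewrite E_Pp /c eqxx.
- by rewrite (negbTE nP) andbF.
Qed.

(* While the token stays alive, each rotation shifts the colours of the cycle by
   one, and the colour of P p never changes; so the cycle is monochromatic. *)
Lemma rotations_mono U k : inv U k -> (live k -> pos k = r) ->
  inv U (iter n rotate k) /\
  (live (iter n rotate k) -> pos (iter n rotate k) = p /\
     forall i, 0 < i < D p -> col (iter n rotate k) (z i) =
                             col (iter n rotate k) (P p)).
Proof.
move=> kI posk; have Dp := Dp_gt2; have Dn := bfs_le pr_bfs p.
have [|dI dL] := descend_spec kI.
  by move=> /posk ->; rewrite (bfs_root pr_bfs).
have : inv U (rotate k) /\ (live (rotate k) -> pos (rotate k) = p).
  split; first by apply: move_inv => // /dL[_ -> _].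
  by case/live_move.
(* The first rotation only takes the hole from [r] to [p]; the remaining [n.-1] ones start at
   [p]. *)
rewrite -(prednK (n:=n)) ?iterSr; last lia.
move: (rotate k) => k1 [k1I posk1].
(* The colour of [P p] enters the cycle at [r] and spreads to one more vertex per rotation, from the
   largest index downwards; [D p <= n] makes [n.-1] rotations enough. *)
suff main m : inv U (iter m rotate k1) /\ (live (iter m rotate k1) ->
    pos (iter m rotate k1) = p /\
    forall i, 0 < i < D p -> D p <= i + m ->
      col (iter m rotate k1) (z i) = col (iter m rotate k1) (P p)).
  have [mI mL] := main n.-1; split=> // /mL[posm colm]; split=> // i ltiD.
  by apply: colm => //; lia.
elim: m => [|m [mI mL]]; first by split=> // /posk1 posp; split=> // i; lia.
have [|rI rL] := rotate_from_p mI; first by case/mL.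
split=> // /rL[lm posr colz colr colP]; have [_ colm] := mL lm.
split=> // i ltiD leD; rewrite iterS in colz colr colP *; rewrite colP.
case: (eqVneq i (D p).-1) => [->|nei]; first by rewrite z_last colr.
by rewrite colz ?colm //; lia.
Qed.

(* After the detour through q, one vertex of the cycle has a colour different from
   P p, and the rotations carry it to P p. *)
Lemma rotations_dead U k q : inv U k ->
  (live k -> [/\ pos k = p, E q p, col k q != col k (P p) &
     forall i, 0 < i < D p -> col k (z i) = col k (P p)]) ->
  inv U (iter n rotate (move q k)) /\ ~~ live (iter n rotate (move q k)).
Proof.
move=> kI kL; have Dp := Dp_gt2; have Dn := bfs_le pr_bfs p.
have mI : inv U (move q k) by apply: move_inv => // /kL[-> Eq _ _].
have [|dI dL] := descend_spec mI.
  by case/live_move=> lk -> _; apply: in_reached; have [] := kL lk.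
have rI : inv U (rotate (move q k)) by apply: move_inv => // /dL[_ -> _].
rewrite -(prednK (n:=n)) ?iterSr; last lia.
(* The detour gives [p] the colour of [q], and the closing move from [r] back to [p] hands it on to
   [r]. *)
have : live (rotate (move q k)) -> [/\ pos (rotate (move q k)) = p,
    col (rotate (move q k)) r != col k (P p)
    & col (rotate (move q k)) (P p) = col k (P p)].
  case/live_move=> /dL[/live_move[lk posq colq] posd cold] -> ->.
  have [posk Eqp colqP colz] := kL lk; rewrite posq posd posk in cold colq *.
  (* No parent is [p], so the descent from [q] leaves the new colour of [p] untouched. *)
  have p_notin : p \notin traject P q (D q).-1.
    apply/trajectP => -[[|i] lti pE].
      by have := E_neq Eqp; rewrite pE eqxx.
    have Di : D (iter i P q) = D q - i by apply: D_iter; lia.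
    have Di_gt0 : 0 < D (iter i P q) by lia.
    have nr : iter i P q != r by rewrite -D_eq1 //; lia.
    by have [_ + _ _] := bfs_parent pr_bfs Di_gt0 nr; rewrite -iterS -pE eqxx.
  (* Since its colour differs from the common one, [q] is none of these cycle vertices. *)
  have colqz i : 0 < i < D p -> col (move q k) (z i) = col k (P p).
    move=> lti; rewrite colq /upd.
    case: eqP => [zq|_]; first by rewrite -zq colz // eqxx in colqP.
    case: eqP => [/(@z_inj i 0)|_]; first lia.
    exact: colz.
  split=> //.
    rewrite /upd (eq_sym r) (negbTE p_neq_r) eqxx cold ?p_neq_r //.
    by rewrite (negbTE p_notin) colq /upd (eq_sym p) (negbTE (E_neq Eqp)) eqxx.
  rewrite /upd (negbTE (E_neq E_Pp)) (negbTE Pp_neq_r) cold ?Pp_neq_r //.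
  (* If the descent passes through [P p], this vertex takes the colour of [z 2], which is still the
     common one; here [D p > 2] is essential. *)
  by case: ifP => _; [rewrite (@colqz 2) | rewrite (@colqz 1)] => //; lia.
move: (rotate (move q k)) rI => k1 k1I k1L.
(* The deviating colour starts at [r] and comes one index closer to [P p] with each rotation. At
   [m = (D p).-2] it would sit at [z 1], and [P p] would differ from itself. *)
suff main m : inv U (iter m rotate k1) /\ (live (iter m rotate k1) ->
    [/\ pos (iter m rotate k1) = p, m < (D p).-2 &
      col (iter m rotate k1) (z ((D p).-1 - m)) !=
      col (iter m rotate k1) (P p)]).
  by have [nI nL] := main n.-1; split=> //; apply/negP => /nL[]; lia.
elim: m => [|m [iI iL]].
  split=> // /k1L[posk1 colr colP]; split=> //; first lia.
  by rewrite subn0 z_last /= colP.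
have [|rI rL] := rotate_from_p iI; first by case/iL.
split=> // /rL[lm posr colz colr colP]; have [_ ltm colm] := iL lm.
rewrite iterS in colz colr colP *.
have colm1 : col (rotate (iter m rotate k1)) (z ((D p).-1 - m.+1)) !=
             col (rotate (iter m rotate k1)) (P p).
  rewrite colz ?colP; last lia.
  have -> : ((D p).-1 - m.+1).+1 = (D p).-1 - m by lia.
  exact: colm.
split=> //; rewrite ltn_neqAle ltm andbT; apply: contraNneq colm1 => mE.
by have -> : (D p).-1 - m.+1 = 1 by lia.
Qed.

End Rotation.

(** * Breadth-first search, level by level *)

Section Scan.
Variables p r : nat.

(* Invariant of the level-by-level search: levels up to i have been scanned, and
   at level i.+1 the pairs lexicographically below (x, y). *)
Record scan (i x y : nat) (D P : nat -> nat) : Prop := Scan {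
  scan_root : D r = 1;
  scan_lt : forall z, 0 < D z -> z < n;
  scan_le : forall z, D z <= i.+2;
  scan_parent : forall z, 0 < D z -> z != r ->
    [/\ E (P z) z, P z != p, 0 < D (P z) & D z = (D (P z)).+1];
  scan_edge : forall u w, E u w -> u != p -> 0 < D u <= i -> 0 < D w <= (D u).+1;
  scan_part : forall u w, E u w -> u != p -> D u = i.+1 ->
    (u < x) || (u == x) && (w < y) -> 0 < D w }.

Lemma scan_init D P : r < n -> D r = 1 -> (forall z, z != r -> D z = 0) ->
  scan 0 0 0 D P.
Proof.
move=> ltr Dr D0; split=> //.
- by move=> z; case: (eqVneq z r) => [->|/D0 ->].
- by move=> z; case: (eqVneq z r) => [->|/D0 ->]; rewrite ?Dr.
- by move=> z Dz /D0 Dz0; rewrite Dz0 in Dz.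
- by move=> u w _ _; lia.
- by move=> u w _ _ _; rewrite ltn0 andbF.
Qed.

Lemma scan_step i x y D P : y < n -> scan i x y D P ->
  [&& D x == i.+1, x != p, E x y & D y == 0] ->
  scan i x y.+1 (upd D y i.+2) (upd P y x).
Proof.
move=> lty [Dr Dlt Dle Dpar Dedge Dpart] /and4P[/eqP Dx nxp Exy /eqP Dy].
have nxy := E_neq Exy; have Dpos z : 0 < D z -> z != y.
  by move=> Dz; apply: contraTneq Dz => ->; rewrite Dy.
have nry : r != y by apply: Dpos; rewrite Dr.
split; rewrite /upd.
- by rewrite (negbTE nry).
- by move=> z; case: eqP => [->|_]; [|apply: Dlt].
- by move=> z; case: eqP.
- move=> z; case: (eqVneq z y) => [-> _ _|nzy Dz nzr].
    by rewrite (negbTE nxy) Dx.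
  by have [EPz nPp DP Dz1] := Dpar z Dz nzr; rewrite (negbTE (Dpos _ DP)).
- move=> u w Euw nup; case: (eqVneq u y) => [_|nuy]; first lia.
  move=> Du; have /andP[Dw1 Dw2] := Dedge u w Euw nup Du.
  by rewrite (negbTE (Dpos _ Dw1)) Dw1.
- move=> u w Euw nup; case: (eqVneq u y) => [_|nuy Du lt_uw]; first lia.
  case: (eqVneq w y) => // nwy; apply: (Dpart u) => //.
  case/orP: lt_uw => [->//|/andP[->]].
  by rewrite ltnS leq_eqVlt (negbTE nwy) /= => ->; rewrite orbT.
Qed.

Lemma scan_skip i x y D P : scan i x y D P ->
  ~~ [&& D x == i.+1, x != p, E x y & D y == 0] -> scan i x y.+1 D P.
Proof.
move=> [Dr Dlt Dle Dpar Dedge Dpart] no; split=> // u w Euw nup Du.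
case/orP=> [ltu|/andP[/eqP eq_ux]]; first by apply: (Dpart u) => //; rewrite ltu.
rewrite ltnS leq_eqVlt => /predU1P[eq_wy|ltw]; last first.
  by apply: (Dpart u); rewrite // eq_ux eqxx ltw orbT.
by move: no; rewrite -eq_ux -eq_wy Du eqxx nup Euw /= lt0n.
Qed.

Lemma scan_row i x D P : scan i x n D P -> scan i x.+1 0 D P.
Proof.
move=> [Dr Dlt Dle Dpar Dedge Dpart]; split=> // u w Euw nup Du.
rewrite ltn0 andbF orbF ltnS leq_eqVlt => lt_u; apply: (Dpart u) => //.
by case/orP: lt_u => ->; rewrite ?(E_ltr Euw) ?orbT.
Qed.

Lemma scan_level i D P : scan i n 0 D P -> scan i.+1 0 0 D P.
Proof.
move=> [Dr Dlt Dle Dpar Dedge Dpart]; split=> //.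
- by move=> z; rewrite (leq_trans (Dle z)).
- move=> u w Euw nup /andP[Du]; rewrite leq_eqVlt.
  case/predU1P=> [Dui|]; last by rewrite ltnS => le; apply: Dedge; rewrite ?Du.
  by rewrite Dui Dle andbT; apply: (Dpart u) => //; rewrite (E_ltl Euw).
- by move=> u w _ _ _; rewrite ltn0 andbF.
Qed.

(** The invariant bounds levels only by [n.+2]. Climbing parents shows that all levels from 1 to
    [D z] occur, so there are at most [n] of them; hence the scanned levels contain every reached
    vertex. *)
Lemma scan_bfs D P : scan n 0 0 D P -> bfs p r D P.
Proof.
move=> [Dr Dlt Dle Dpar Dedge Dpart].
have Dn z : D z <= n.
  have lvl l : l < D z -> exists2 y, 0 < D y & D y = D z - l.
    elim: l => [|l IHl] ltl; first by exists z; rewrite ?subn0.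
    have [y Dy yl] := IHl (ltnW ltl).
    have nyr : y != r by apply: contraTneq ltl => eqy; rewrite eqy Dr in yl; lia.
    by have [_ _ DP Dy1] := Dpar y Dy nyr; exists (P y) => //; lia.
  have /(uniq_leq_size (iota_uniq 1 (D z))) :
      {subset iota 1 (D z) <= [seq D y | y <- iota 0 n]}.
    move=> l; rewrite mem_iota add1n ltnS => /andP[l_gt0 lel].
    have [|y Dy yl] := lvl (D z - l); first lia.
    apply/mapP; exists y; last lia.
    by rewrite mem_iota Dlt.
  by rewrite size_map !size_iota.
by split=> // x y Exy nxp Dx; apply: Dedge => //; rewrite Dx Dn.
Qed.

End Scan.

(** * Progress of the search for the cycle *)

Definition reached (p : nat) (D : nat -> nat) : nat :=
  count (fun y => (y != p) && (0 < D y)) (iota 0 n).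

Lemma reached_lt p D : p < n -> reached p D < n.
Proof.
move=> ltp; rewrite -[X in _ < X](size_iota 0) -count_predT.
by apply: (@count_lt _ _ _ _ p); rewrite ?mem_iota //= eqxx.
Qed.

(** The reached set depends only on [p] and [r], so facts about one search table transfer to any
    other. *)
Lemma bfs_reached p r D P D' P' y :
  bfs p r D P -> bfs p r D' P' -> 0 < D y -> 0 < D' y.
Proof.
move=> B B'; have [m] := ubnP (D y); elim: m y => // m IHm y lem Dy.
case: (eqVneq y r) => [->|nyr]; first by rewrite (bfs_root B').
have [EPy nPp DPy Dyq] := bfs_parent B Dy nyr.
have DP' : 0 < D' (P y) by apply: IHm => //; lia.
by have /andP[] := bfs_edge B' EPy nPp DP'.
Qed.

(** The search paths from [r] avoid the unreached vertex [q], so the edge from [p] to [r] prolongs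
    them to paths from [p] that avoid [q]. The vertex [p], left out of the first count, enters the
    second. *)
Lemma reached_grow p r q D P D' P' : bfs p r D P -> bfs q p D' P' ->
  E p r -> E q p -> D q = 0 -> reached p D < reached q D'.
Proof.
move=> B B' Epr Eqp Dq.
have sub y : 0 < D y -> 0 < D' y.
  move=> Dy; have [m] := ubnP (D y); elim: m y Dy => // m IHm y Dy lem.
  case: (eqVneq y r) => [->|nyr].
    have D'p : 0 < D' p by rewrite (bfs_root B').
    have npq : p != q by rewrite eq_sym E_neq.
    by have /andP[] := bfs_edge B' Epr npq D'p.
  have [EPy _ DPy Dyq] := bfs_parent B Dy nyr.
  have DP' : 0 < D' (P y) by apply: IHm => //; lia.
  have nPq : P y != q by apply: contraTneq DPy => ->; rewrite Dq.
  by have /andP[] := bfs_edge B' EPy nPq DP'.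
apply: (@count_lt _ _ _ _ p) => [y /andP[_ Dy]|||].
- by rewrite sub // andbT; apply: contraTneq Dy => ->; rewrite Dq.
- by rewrite mem_iota (E_ltl Epr).
- by rewrite (bfs_root B') eq_sym E_neq.
- by rewrite eqxx.
Qed.

End Token.


(** * A structured language compiled to the random access machine *)

Inductive expr : Type :=
| EVar of nat
| ECst of nat
| EAdd of expr & expr
| ESub of expr & expr
| EArr of nat & expr.

Inductive cmd : Type :=
| CSet of nat & expr
| CPut of nat & expr & expr
| CRead of nat
| CPrint of expr
| CSeq of cmd & cmd
| CIf of expr & cmd
| CFor of nat & cmd.

Record store : Type := Store {
  var : nat -> nat;
  arr : nat -> nat -> nat;
  inp : seq nat;
  out : seq nat }.

Definition set_var (s : store) (x c : nat) : store :=
  Store (upd (var s) x c) (arr s) (inp s) (out s).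

Definition set_arr (s : store) (a i c : nat) : store :=
  Store (var s) (fun b => if b == a then upd (arr s a) i c else arr s b)
        (inp s) (out s).

Fixpoint eval (s : store) (e : expr) : nat :=
  match e with
  | EVar x => var s x
  | ECst c => c
  | EAdd e1 e2 => eval s e1 + eval s e2
  | ESub e1 e2 => eval s e1 - eval s e2
  | EArr a e1 => arr s a (eval s e1)
  end.

(* The bound of every loop is the value of variable 0. *)
Fixpoint run (c : cmd) (s : store) : store :=
  match c with
  | CSet x e => set_var s x (eval s e)
  | CPut a e1 e2 => set_arr s a (eval s e1) (eval s e2)
  | CRead x => let s' := set_var s x (head 0 (inp s)) in
               Store (var s') (arr s') (behead (inp s)) (out s')
  | CPrint e => Store (var s) (arr s) (inp s) (rcons (out s) (eval s e))
  | CSeq c1 c2 => run c2 (run c1 s)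
  | CIf e c1 => if 0 < eval s e then run c1 s else s
  | CFor x c1 =>
      set_var (foldl (fun s' i => run c1 (set_var s' x i)) s (iota 0 (var s 0)))
              x (var s 0)
  end.

Fixpoint writes (c : cmd) : seq nat :=
  match c with
  | CSet x _ | CRead x => [:: x]
  | CPut _ _ _ | CPrint _ => [::]
  | CSeq c1 c2 => writes c1 ++ writes c2
  | CIf _ c1 => writes c1
  | CFor x c1 => x :: writes c1
  end.

Fixpoint arr_writes (c : cmd) : seq nat :=
  match c with
  | CPut a _ _ => [:: a]
  | CSet _ _ | CRead _ | CPrint _ => [::]
  | CSeq c1 c2 => arr_writes c1 ++ arr_writes c2
  | CIf _ c1 | CFor _ c1 => arr_writes c1
  end.

Fixpoint prints (c : cmd) : bool :=
  match c with
  | CPrint _ => true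
  | CSet _ _ | CPut _ _ _ | CRead _ => false
  | CSeq c1 c2 => prints c1 || prints c2
  | CIf _ c1 | CFor _ c1 => prints c1
  end.

Lemma foldl_inv (S : Type) (f : S -> nat -> S) (Q : nat -> S -> Prop) s n :
  Q 0 s -> (forall i s', i < n -> Q i s' -> Q i.+1 (f s' i)) ->
  Q n (foldl f s (iota 0 n)).
Proof.
move=> Q0 QS; elim: n QS => [|n IHn] QS //.
rewrite -addn1 iotaD foldl_cat add0n addn1 /=; apply: (QS) => //.
by apply: IHn => i s' /ltnW; exact: QS.
Qed.

Lemma var_run c s x : x \notin writes c -> var (run c s) x = var s x.
Proof.
elim: c s => [y e|a e1 e2|y|e|c1 IH1 c2 IH2|e c1 IH|y c1 IH] s //=.
- by rewrite inE /upd => /negbTE ->.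
- by rewrite inE /upd => /negbTE ->.
- by rewrite mem_cat negb_or => /andP[? ?]; rewrite IH2 ?IH1.
- by case: ifP => // _; apply: IH.
- rewrite inE negb_or => /andP[/negbTE nxy ?]; rewrite /upd nxy.
  pose Q (_ : nat) s' := var s' x = var s x.
  apply: (@foldl_inv _ _ Q) => // i s' _; rewrite /Q => <-.
  by rewrite IH // /= /upd nxy.
Qed.

Lemma arr_run c s a : a \notin arr_writes c -> arr (run c s) a = arr s a.
Proof.
elim: c s => [y e|b e1 e2|y|e|c1 IH1 c2 IH2|e c1 IH|y c1 IH] s //=.
- by rewrite inE => /negbTE ->.
- by rewrite mem_cat negb_or => /andP[? ?]; rewrite IH2 ?IH1.
- by case: ifP => // _; apply: IH.
- move=> na; pose Q (_ : nat) s' := arr s' a = arr s a.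
  by apply: (@foldl_inv _ _ Q) => // i s' _; rewrite /Q => <-; rewrite IH.
Qed.

Lemma out_run c s : ~~ prints c -> out (run c s) = out s.
Proof.
elim: c s => [y e|b e1 e2|y|e|c1 IH1 c2 IH2|e c1 IH|y c1 IH] s //=.
- by rewrite negb_or => /andP[? ?]; rewrite IH2 ?IH1.
- by case: ifP => // _; apply: IH.
- move=> na; pose Q (_ : nat) s' := out s' = out s.
  by apply: (@foldl_inv _ _ Q) => // i s' _; rewrite /Q => <-; rewrite IH.
Qed.

(** The invariant must not depend on the counter [x], which the loop sets before each pass and once
    more at the end. In return, the body is verified knowing that everything unwritten keeps its
    initial value. *)
Lemma run_for (Q : nat -> store -> Prop) x c s :
  (forall i s' k, Q i s' -> Q i (set_var s' x k)) ->
  x != 0 -> 0 \notin writes c ->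
  Q 0 s ->
  (forall i s', i < var s 0 -> var s' x = i ->
    (forall y, y \notin x :: writes c -> var s' y = var s y) ->
    (forall a, a \notin arr_writes c -> arr s' a = arr s a) ->
    Q i s' -> Q i.+1 (run c s')) ->
  Q (var s 0) (run (CFor x c) s).
Proof.
move=> Qx nx0 nc Q0 QS /=; apply: (Qx).
pose Q' i s' := [/\ Q i s',
  forall y, y \notin x :: writes c -> var s' y = var s y
  & forall a, a \notin arr_writes c -> arr s' a = arr s a].
suff [] : Q' (var s 0)
  (foldl (fun s' i => run c (set_var s' x i)) s (iota 0 (var s 0))) by [].
apply: (@foldl_inv _ _ Q') => // i s' lti [Qi s'v s'a].
have fr y : y \notin x :: writes c -> var (set_var s' x i) y = var s y.
  by move=> ny; rewrite -s'v //= /upd; case: eqP ny => // ->; rewrite inE eqxx.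
split.
- apply: QS => //; first by rewrite /= /upd eqxx.
  exact: Qx.
- move=> y ny; rewrite var_run ?fr //.
  by apply: contra ny => yc; rewrite inE yc orbT.
- by move=> a na; rewrite arr_run // s'a.
Qed.

Lemma run_seq c1 c2 s : run (CSeq c1 c2) s = run c2 (run c1 s).
Proof. by []. Qed.

Lemma run_if e c s : run (CIf e c) s = if 0 < eval s e then run c s else s.
Proof. by []. Qed.

Lemma run_set x e s : run (CSet x e) s = set_var s x (eval s e).
Proof. by []. Qed.

Lemma run_put a e1 e2 s :
  run (CPut a e1 e2) s = set_arr s a (eval s e1) (eval s e2).
Proof. by []. Qed.

(** * Compilation and its correctness *)

Section Compiler.

(* Variable x lives in register x < nv, the temporaries used to evaluate
   expressions in the next nd registers, and the na arrays are interleaved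
   after them. *)
Variables nv nd na : nat.

Definition addr (a i : nat) : nat := nv + nd + (a + na * i).

(** The result goes to temporary [d]. The machine neither copies nor multiplies: a copy is an
    addition to zero, and [na * i] takes [na] additions. *)
Fixpoint comp_expr (d : nat) (e : expr) : program :=
  match e with
  | EVar x => [:: RConst (nv + d) 0; RAdd (nv + d) x (nv + d)]
  | ECst c => [:: RConst (nv + d) c]
  | EAdd e1 e2 => comp_expr d e1 ++ comp_expr d.+1 e2 ++
                  [:: RAdd (nv + d) (nv + d) (nv + d.+1)]
  | ESub e1 e2 => comp_expr d e1 ++ comp_expr d.+1 e2 ++
                  [:: RSub (nv + d) (nv + d) (nv + d.+1)]
  | EArr a e1 => comp_expr d e1 ++ RConst (nv + d.+1) (nv + nd + a) ::
      nseq na (RAdd (nv + d.+1) (nv + d.+1) (nv + d)) ++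
      [:: RLoad (nv + d) (nv + d.+1)]
  end.

Fixpoint wf_expr (d : nat) (e : expr) : bool :=
  match e with
  | EVar x => (x < nv) && (d < nd)
  | ECst _ => d < nd
  | EAdd e1 e2 | ESub e1 e2 => wf_expr d e1 && wf_expr d.+1 e2
  | EArr a e1 => [&& a < na, d.+1 < nd & wf_expr d e1]
  end.

(** Jump targets are absolute, so the address [k] of the code is a parameter. As jumps test
    positivity, a body is skipped on [1 - e] and a loop repeated on the bound minus the counter. *)
Fixpoint comp (k : nat) (c : cmd) : program :=
  match c with
  | CSet x e => comp_expr 0 e ++
      [:: RConst (nv + 1) 0; RAdd x (nv + 0) (nv + 1)]
  | CPut a e1 e2 => comp_expr 0 e1 ++ comp_expr 1 e2 ++
      RConst (nv + 2) (nv + nd + a) ::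
      nseq na (RAdd (nv + 2) (nv + 2) (nv + 0)) ++
      [:: RStore (nv + 2) (nv + 1)]
  | CRead x => [:: RRead x]
  | CPrint e => comp_expr 0 e ++ [:: RPrint (nv + 0)]
  | CSeq c1 c2 => let l1 := comp k c1 in l1 ++ comp (k + size l1) c2
  | CIf e c1 =>
      let l := comp_expr 0 e in
      let l1 := comp (k + size l + 3) c1 in
      l ++ [:: RConst (nv + 1) 1; RSub (nv + 0) (nv + 1) (nv + 0);
               RJump (k + size l + 3 + size l1) (nv + 0)] ++ l1
  | CFor x c1 =>
      let l1 := comp (k + 4) c1 in
      [:: RConst x 0; RConst (nv + 0) 1; RSub (nv + 0) (nv + 0) 0;
          RJump (k + 4 + size l1 + 4) (nv + 0)] ++ l1 ++
      [:: RConst (nv + 0) 1; RAdd x x (nv + 0); RSub (nv + 0) 0 x;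
          RJump (k + 4) (nv + 0)]
  end.

Fixpoint wf (c : cmd) : bool :=
  match c with
  | CSet x e => (x < nv) && wf_expr 0 e
  | CPut a e1 e2 => [&& a < na, wf_expr 0 e1 & wf_expr 1 e2]
  | CRead x => x < nv
  | CPrint e => wf_expr 0 e
  | CSeq c1 c2 => wf c1 && wf c2
  | CIf e c1 => wf_expr 0 e && wf c1
  | CFor x c1 => [&& x < nv, x \notin writes c1 & wf c1]
  end.

Fixpoint cost (c : cmd) (N : nat) : nat :=
  match c with
  | CSet _ _ | CPut _ _ _ | CRead _ | CPrint _ => size (comp 0 c)
  | CSeq c1 c2 => cost c1 N + cost c2 N
  | CIf e c1 => size (comp_expr 0 e) + 3 + cost c1 N
  | CFor _ c1 => 4 + (cost c1 N + 4) * N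
  end.

(** All loops share the bound [N], so the cost is a polynomial in [N] of degree at most the nesting
    depth. *)
Fixpoint cost_poly (c : cmd) : {poly nat} :=
  match c with
  | CSet _ _ | CPut _ _ _ | CRead _ | CPrint _ => (size (comp 0 c))%:P
  | CSeq c1 c2 => cost_poly c1 + cost_poly c2
  | CIf e c1 => (size (comp_expr 0 e) + 3)%N%:P + cost_poly c1
  | CFor _ c1 => 4%N%:P + (cost_poly c1 + 4%N%:P) * 'X
  end%R.

Lemma horner_cost_poly c N : ((cost_poly c).[N])%R = cost c N.
Proof.
elim: c => [y e|b e1 e2|y|e|c1 IH1 c2 IH2|e c1 IH|y c1 IH];
  rewrite /cost_poly -/cost_poly;
  by rewrite ?(hornerD, hornerMX, hornerC) ?IH1 ?IH2 ?IH.
Qed.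

Lemma leq_cost c N N' : N <= N' -> cost c N <= cost c N'.
Proof.
move=> leN; elim: c => //= [c1 IH1 c2 IH2|e c1 IH|x c1 IH].
- exact: leq_add.
- by rewrite leq_add2l.
- by rewrite leq_add2l leq_mul // leq_add2r.
Qed.

Definition code_at (P : program) (k : nat) (l : program) : Prop :=
  exists l1 l2, P = l1 ++ l ++ l2 /\ size l1 = k.

Lemma code_at_cat P k l1 l2 :
  code_at P k (l1 ++ l2) -> code_at P k l1 /\ code_at P (k + size l1) l2.
Proof.
case=> p [q [-> <-]]; split; first by exists p, (l2 ++ q); rewrite -catA.
by exists (p ++ l1), q; rewrite -!catA size_cat.
Qed.

Lemma code_at_cons P k a l :
  code_at P k (a :: l) -> onth P k = Some a /\ code_at P k.+1 l.
Proof.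
case=> p [q [-> <-]]; split; first by rewrite onth_cat ltnn subnn.
by exists (rcons p a), q; rewrite cat_rcons size_rcons.
Qed.

Definition steps (P : program) (t : nat) (s s' : config) : Prop :=
  iter t (step P) s = s'.

Lemma steps_refl P s : steps P 0 s s.
Proof. by []. Qed.

Lemma steps_exec P a k X x y t s : onth P k = Some a ->
  steps P t (exec a (Config k X x y)) s -> steps P t.+1 (Config k X x y) s.
Proof. by move=> Pk; rewrite /steps iterSr {3}/step /= Pk. Qed.

Lemma steps_trans P t1 t2 s1 s2 s3 :
  steps P t1 s1 s2 -> steps P t2 s2 s3 -> steps P (t1 + t2) s1 s3.
Proof. by rewrite /steps addnC iterD => -> ->. Qed.

Lemma updE X i c k : upd X i c k = if k == i then c else X k.
Proof. by []. Qed.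

Lemma steps_mul P k i j n X x y :
  i != j -> code_at P k (nseq n (RAdd i i j)) ->
  exists X', [/\ steps P n (Config k X x y) (Config (k + n) X' x y),
    X' i = X i + n * X j & forall h, h != i -> X' h = X h].
Proof.
move=> nij; elim: n k X => [|n IHn] k X /=.
  by exists X; rewrite addn0 mul0n addn0.
case/code_at_cons=> Pk /IHn - /(_ (upd X i (X i + X j)))[X' [run_n X'i X'h]].
exists X'; split.
- by apply: (steps_exec Pk); rewrite addnS -addSn.
- by rewrite X'i !updE eqxx eq_sym (negbTE nij) mulSn addnA.
- by move=> h nh; rewrite X'h // updE (negbTE nh).
Qed.

Definition repr (s : store) (X : nat -> nat) : Prop :=
  (forall x, x < nv -> X x = var s x) /\
  (forall a i, a < na -> X (addr a i) = arr s a i).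

Definition frame (d : nat) (X X' : nat -> nat) : Prop :=
  forall h, (h < nv + d) || (nv + nd <= h) -> X' h = X h.

Lemma frame_repr s d X X' : frame d X X' -> repr s X -> repr s X'.
Proof.
move=> fr [Xv Xa]; split=> [x ltx|a i lta].
- by rewrite fr ?Xv // ltn_addr.
- by rewrite fr ?Xa // leq_addr orbT.
Qed.

Lemma frame_trans d d' X Y Z :
  d <= d' -> frame d X Y -> frame d' Y Z -> frame d X Z.
Proof. by move=> led XY YZ h hh; rewrite YZ ?XY //; lia. Qed.

Lemma steps_arr_addr P k d i a X x y :
  d != i -> code_at P k (RConst (nv + d) (nv + nd + a) ::
                         nseq na (RAdd (nv + d) (nv + d) (nv + i))) ->
  exists X', [/\ steps P na.+1 (Config k X x y) (Config (k + na.+1) X' x y),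
    X' (nv + d) = addr a (X (nv + i)) & forall h, h != nv + d -> X' h = X h].
Proof.
move=> ndi /code_at_cons[Pk] /steps_mul.
rewrite eqn_add2l => /(_ (upd X (nv + d) (nv + nd + a)) x y ndi).
move=> [X' [run_n X'd X'h]]; exists X'; split.
- by apply: (steps_exec Pk); rewrite addnS -addSn.
- by rewrite X'd !updE eqxx eqn_add2l eq_sym (negbTE ndi) /addr addnA.
- by move=> h nh; rewrite X'h // updE (negbTE nh).
Qed.

Lemma wf_expr_depth d e : wf_expr d e -> d < nd.
Proof.
by elim: e d => [v|c|e1 IH1 e2 _|e1 IH1 e2 _|a e1 IH1] d //= => [|||]
  /andP[] // => [/IH1|/IH1|_ /andP[_ /IH1]].
Qed.

Lemma comp_exprP P k d e s X x y :
  code_at P k (comp_expr d e) -> wf_expr d e -> repr s X ->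
  exists X', [/\ steps P (size (comp_expr d e)) (Config k X x y)
                   (Config (k + size (comp_expr d e)) X' x y),
    X' (nv + d) = eval s e & frame d X X'].
Proof.
(* Addition and subtraction differ only in the instruction, so both are covered at once. *)
have binop op eop k' d' X' e1 e2 :
    (forall i j h k X, exec (op i j h) (Config k X x y)
                       = Config k.+1 (upd X i (eop (X j) (X h))) x y) ->
    (forall k d X, code_at P k (comp_expr d e1) -> wf_expr d e1 -> repr s X ->
       exists X', [/\ steps P (size (comp_expr d e1)) (Config k X x y)
                   (Config (k + size (comp_expr d e1)) X' x y),
        X' (nv + d) = eval s e1 & frame d X X']) ->
    (forall k d X, code_at P k (comp_expr d e2) -> wf_expr d e2 -> repr s X ->
       exists X', [/\ steps P (size (comp_expr d e2)) (Config k X x y)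
                   (Config (k + size (comp_expr d e2)) X' x y),
        X' (nv + d) = eval s e2 & frame d X X']) ->
    let l := comp_expr d' e1 ++ comp_expr d'.+1 e2 ++
             [:: op (nv + d') (nv + d') (nv + d'.+1)] in
    code_at P k' l -> wf_expr d' e1 && wf_expr d'.+1 e2 -> repr s X' ->
    exists X'', [/\ steps P (size l) (Config k' X' x y)
                   (Config (k' + size l) X'' x y),
      X'' (nv + d') = eop (eval s e1) (eval s e2) & frame d' X' X''].
  move=> opE IH1 IH2 l /code_at_cat[Pk1 /code_at_cat[Pk2 /code_at_cons[Pk3 _]]].
  case/andP=> wf1 wf2 sX; have ltd := wf_expr_depth wf2.
  have [X1 [st1 X1d fr1]] := IH1 _ _ _ Pk1 wf1 sX.
  have [X2 [st2 X2d fr2]] := IH2 _ _ _ Pk2 wf2 (frame_repr fr1 sX).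
  exists (upd X2 (nv + d') (eop (X2 (nv + d')) (X2 (nv + d'.+1)))); split.
  - rewrite /l !size_cat !addnA; apply: steps_trans (steps_trans st1 st2) _.
    apply: (steps_exec Pk3); rewrite addn1 opE; apply: steps_refl.
  - by rewrite updE eqxx X2d fr2 ?X1d //; apply/orP; left; lia.
  - move=> h hh; rewrite updE; case: eqP => [|_]; first lia.
    by rewrite fr2 ?fr1 //; lia.
elim: e k d X => [v|c|e1 IH1 e2 IH2|e1 IH1 e2 IH2|a e1 IH1] k d X.
- move=> /code_at_cons[Pk /code_at_cons[Pk1 _]] /andP[vn dn] [Xv Xa].
  eexists; split.
  + apply: (steps_exec Pk); apply: (steps_exec Pk1).
    by rewrite addn2; apply: steps_refl.
  + rewrite !updE eqxx /=; case: eqP => [|_]; first lia.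
    by rewrite Xv // addn0.
  + move=> h hn; rewrite !updE; case: eqP => // ?; lia.
- move=> /code_at_cons[Pk _] dn _.
  eexists; split.
  + by apply: (steps_exec Pk); rewrite addn1; apply: steps_refl.
  + by rewrite updE eqxx.
  + move=> h hn; rewrite !updE; case: eqP => // ?; rewrite /= in dn; lia.
- by move=> Pk wfe sX; apply: (binop RAdd addn _ _ _ _ _ _ IH1 IH2).
- by move=> Pk wfe sX; apply: (binop RSub subn _ _ _ _ _ _ IH1 IH2).
- rewrite /= => /code_at_cat[Pk1]; rewrite -cat_cons => /code_at_cat[Pk2].
  move=> /code_at_cons[Pk3 _] /and3P[lta ltd wfe] sX.
  have [X1 [st1 X1d fr1]] := IH1 _ _ _ Pk1 wfe sX.
  have [|X2 [st2 X2d fr2]] := steps_arr_addr X1 x y _ Pk2; first lia.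
  exists (upd X2 (nv + d) (X2 (X2 (nv + d.+1)))); split.
  + rewrite !size_cat /= size_nseq addn1 -[na.+2]addn1 !addnA.
    apply: steps_trans (steps_trans st1 st2) _.
    rewrite [size (_ :: _)]/= size_nseq in Pk3.
    by apply: (steps_exec Pk3); rewrite addn1.
  + rewrite updE eqxx X2d X1d fr2; last by rewrite /addr; lia.
    by case: (frame_repr fr1 sX) => _ ->.
  + move=> h hh; rewrite updE; case: eqP => [|_]; first lia.
    by rewrite fr2 ?fr1 //; lia.
Qed.

Lemma repr_set_var s X x c :
  x < nv -> repr s X -> repr (set_var s x c) (upd X x c).
Proof.
move=> ltx [Xv Xa]; split=> [y lty|a i lta] /=; rewrite updE.
  by rewrite /upd Xv.
by rewrite Xa //; case: eqP => //; rewrite /addr; lia.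
Qed.

(** Up to a shift, [addr a i] is the number with quotient [i] and remainder [a] modulo [na]. *)
Lemma addr_inj a b i j :
  a < na -> b < na -> addr a i = addr b j -> a = b /\ i = j.
Proof.
move=> lta ltb /eqP; rewrite /addr eqn_add2l => /eqP eq_ab.
have na0 : 0 < na by apply: leq_ltn_trans lta.
split; first by have := congr1 (modn^~ na) eq_ab;
  rewrite !(mulnC na) ![_ + _ * na]addnC !modnMDl !modn_small.
by have := congr1 (divn^~ na) eq_ab;
  rewrite !(mulnC na) ![_ + _ * na]addnC !divnMDl // !divn_small // !addn0.
Qed.

Lemma repr_set_arr s X a i c :
  a < na -> repr s X -> repr (set_arr s a i c) (upd X (addr a i) c).
Proof.
move=> lta [Xv Xa]; split=> [y lty|b j ltb] /=; rewrite /upd.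
  by rewrite Xv //; case: eqP => //; rewrite /addr; lia.
rewrite Xa //; case: (eqVneq b a) => [->|nba].
  by case: (eqVneq j i) => [->|nij]; rewrite ?eqxx //; case: eqP => // /addr_inj
    [] //= _ /eqP; rewrite (negbTE nij).
by case: eqP => // /addr_inj [] // /eqP; rewrite (negbTE nba).
Qed.

(** Simulation by induction on the command. Variable 0 must stay constant, being both the bound of
    all loops and the argument of [cost]. *)
Lemma compP P k c s X :
  code_at P k (comp k c) -> wf c -> 0 < nv -> 2 < nd -> 0 \notin writes c ->
  repr s X ->
  exists t X', [/\ t <= cost c (var s 0),
    steps P t (Config k X (inp s) (out s))
      (Config (k + size (comp k c)) X' (inp (run c s)) (out (run c s)))
    & repr (run c s) X'].
Proof.
move=> + + nv0 nd2.
elim: c k s X => [v e|a e1 e2|v|e|c1 IH1 c2 IH2|e c1 IH|v c1 IH] k s X.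
- move=> /code_at_cat[Pk1 /code_at_cons[Pk2 /code_at_cons[Pk3 _]]].
  move=> /andP[ltv wfe] _ sX.
  have [X1 [st1 X1d fr1]] := comp_exprP (inp s) (out s) Pk1 wfe sX.
  exists (size (comp 0 (CSet v e))), (upd (upd X1 (nv + 1) 0) v (eval s e)).
  split=> //.
    rewrite !size_cat /= addnA; apply: steps_trans st1 _.
    apply: (steps_exec Pk2); apply: (steps_exec Pk3).
    by rewrite addn2 /exec !updE eqxx eqn_add2l /= addn0 X1d; apply: steps_refl.
  apply: repr_set_var => //; apply: frame_repr (frame_trans _ fr1 _) sX.
    exact: leqnn.
  by move=> h hh; rewrite updE; case: eqP => // ?; lia.
- rewrite /= -cat_cons => /code_at_cat[Pk1 /code_at_cat[Pk2]].
  move=> /code_at_cat[Pk3 /code_at_cons[Pk4 _]] /and3P[lta wf1 wf2] _ sX.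
  have [X1 [st1 X1d fr1]] := comp_exprP (inp s) (out s) Pk1 wf1 sX.
  have sX1 := frame_repr fr1 sX.
  have [X2 [st2 X2d fr2]] := comp_exprP (inp s) (out s) Pk2 wf2 sX1.
  have [|X3 [st3 X3d fr3]] := steps_arr_addr X2 (inp s) (out s) _ Pk3 => //.
  exists (size (comp_expr 0 e1 ++ comp_expr 1 e2 ++
    (RConst (nv + 2) (nv + nd + a) ::
      nseq na (RAdd (nv + 2) (nv + 2) (nv + 0))) ++
      [:: RStore (nv + 2) (nv + 1)])).
  exists (upd X3 (addr a (eval s e1)) (eval s e2)); split=> //.
    rewrite !size_cat [size (RConst _ _ :: _)]/= size_nseq !addnA.
    rewrite [size (_ :: _)]/= size_nseq in Pk4.
    apply: steps_trans (steps_trans (steps_trans st1 st2) st3) _.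
    apply: (steps_exec Pk4); rewrite /exec X3d fr3; last lia.
    by rewrite X2d fr2 ?X1d ?addn1; [apply: steps_refl | lia].
  apply: repr_set_arr => //.
  apply: frame_repr (@frame_trans 1 2 _ _ _ _ fr2 _) sX1 => //.
  by move=> h hh; rewrite fr3 //; lia.
- move=> /code_at_cons[Pk _] ltv _ sX; exists 1; eexists; split=> //.
    by apply: (steps_exec Pk); rewrite addn1; apply: steps_refl.
  exact: repr_set_var.
- move=> /code_at_cat[Pk1 /code_at_cons[Pk2 _]] wfe _ sX.
  have [X1 [st1 X1d fr1]] := comp_exprP (inp s) (out s) Pk1 wfe sX.
  exists (size (comp k (CPrint e))), X1; split=> //; last exact: frame_repr fr1 sX.
  rewrite size_cat /= addnA; apply: steps_trans st1 _.
  by apply: (steps_exec Pk2); rewrite addn1 /= X1d.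
- move=> /code_at_cat[Pk1 Pk2] /andP[wf1 wf2].
  rewrite [writes _]/= mem_cat negb_or => /andP[n1 n2] sX.
  have [t1 [X1 [le1 st1 sX1]]] := IH1 _ _ _ Pk1 wf1 n1 sX.
  have [t2 [X2 [le2 st2 sX2]]] := IH2 _ _ _ Pk2 wf2 n2 sX1.
  exists (t1 + t2), X2; split=> //.
    by rewrite leq_add // (leq_trans le2) // var_run.
  by rewrite size_cat addnA; apply: steps_trans st1 st2.
- set l := comp_expr 0 e; set k1 := k + size l + 3.
  rewrite [comp _ _]/= -/l -/k1 => /code_at_cat[Pk1].
  move=> /code_at_cons[Pk2 /code_at_cons[Pk3 /code_at_cons[Pk4]]].
  rewrite -[X in code_at P X]addn3 -/k1 => Pk5.
  move=> /andP[wfe wf1] /= n1 sX.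
  have [X1 [st1 X1d fr1]] := comp_exprP (inp s) (out s) Pk1 wfe sX.
  set X2 := upd (upd X1 (nv + 1) 1) (nv + 0) (1 - eval s e).
  have sX2 : repr s X2.
    apply: frame_repr (frame_trans _ fr1 _) sX; first exact: leqnn.
    by move=> h hh; rewrite /X2 !updE; do 2 (case: eqP => [|_]; first lia).
  have st2 : steps P (size l + 3) (Config k X (inp s) (out s))
      (Config (if eval s e == 0 then k1 + size (comp k1 c1) else k1) X2
        (inp s) (out s)).
    apply: steps_trans st1 _.
    apply: (steps_exec Pk2); apply: (steps_exec Pk3); apply: (steps_exec Pk4).
    rewrite /exec !updE eqxx eqn_add2l X1d subn_gt0 ltnS leqn0.
    by rewrite -[_.+3]addn3 eqn_add2l; apply: steps_refl.
  have sizeE l' : k + size (l ++ [:: RConst (nv + 1) 1,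
      RSub (nv + 0) (nv + 1) (nv + 0), RJump (k1 + size l') (nv + 0) & l'])
      = k1 + size l' by rewrite size_cat /k1 /=; lia.
  case: ltnP => [e_gt0|]; last first.
    rewrite leqn0 => e0; rewrite e0 in st2; exists (size l + 3), X2.
    by rewrite sizeE leq_addr; split.
  rewrite eqn0Ngt e_gt0 in st2.
  have [t1 [X3 [le1 st3 sX3]]] := IH _ _ _ Pk5 wf1 n1 sX2.
  exists (size l + 3 + t1), X3; rewrite sizeE leq_add2l; split=> //.
  exact: steps_trans st2 st3.
- rewrite [comp _ _]/=; set l1 := comp (k + 4) c1.
  move=> /code_at_cons[Pk1 /code_at_cons[Pk2 /code_at_cons[Pk3 /code_at_cons[Pk4]]]].
  rewrite -[X in code_at P X]addn4 => /code_at_cat[Pk5].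
  move=> /code_at_cons[Pk6 /code_at_cons[Pk7 /code_at_cons[Pk8 /code_at_cons[Pk9 _]]]].
  move=> /and3P[ltv nv1 wf1] /=; rewrite inE negb_or => /andP[n0v n01] sX.
  have v0 : (v == 0) = false by apply/negbTE; rewrite eq_sym.
  have vnv : (v == nv + 0) = false by lia.
  have nv_neq0 : (0 == nv + 0) = false by lia.
  set N := var s 0; set k1 := k + 4.
  have X0 : X 0 = N by case: sX => ->.
  set S := fun i => foldl (fun s' j => run c1 (set_var s' v j)) s (iota 0 i).
  have SS i : S i.+1 = run c1 (set_var (S i) v i).
    by rewrite /S -[i.+1]addn1 iotaD foldl_cat.
  have S0 i : var (S i) 0 = N.
    elim: i => // i IHi; rewrite SS var_run //= updE eq_sym v0.
    exact: IHi.
  set X1 := upd (upd (upd X v 0) (nv + 0) 1) (nv + 0) (1 - N).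
  have st1 : steps P 4 (Config k X (inp s) (out s))
      (Config (if N == 0 then k1 + size l1 + 4 else k1) X1 (inp s) (out s)).
    apply: (steps_exec Pk1); apply: (steps_exec Pk2); apply: (steps_exec Pk3).
    apply: (steps_exec Pk4); rewrite /exec !updE eqxx nv_neq0.
    rewrite (eq_sym 0 v) v0 X0 subn_gt0 ltnS leqn0 /k1 -[k.+4]addn4.
    exact: steps_refl.
  have sX1 : repr (set_var s v 0) X1.
    apply: (@frame_repr _ 0 (upd X v 0)); last exact: repr_set_var.
    by move=> h hh; rewrite /X1 2!updE; case: eqP => // ?; lia.
  (* The state is taken after the test that follows [i] passes: the counter is already [i], and
     control has left the loop exactly when [i = N]. *)
  have loop i : 0 < N -> i <= N -> exists t X', [/\ t <= (cost c1 N + 4) * i,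
      steps P t (Config k1 X1 (inp s) (out s))
        (Config (if i == N then k1 + size l1 + 4 else k1) X'
           (inp (S i)) (out (S i)))
      & repr (set_var (S i) v i) X'].
    move=> N_gt0; elim: i => [|i IHi] leN.
      exists 0, X1; rewrite muln0 eq_sym -[N == 0]negbK -lt0n N_gt0.
      by split=> //; apply: steps_refl.
    have [t [X2 [le1 st sX2]]] := IHi (ltnW leN).
    rewrite (ltn_eqF leN) in st.
    have [t1 [X3 [le2 st2 sX3]]] := IH _ _ _ Pk5 wf1 n01 sX2.
    rewrite -SS in st2 sX3.
    have X30 : X3 0 = N by case: sX3 => -> //; rewrite S0.
    have X3v : X3 v = i by case: sX3 => -> //; rewrite SS var_run //= updE eqxx.
    exists (t + t1 + 4).
    exists (upd (upd (upd X3 (nv + 0) 1) v i.+1) (nv + 0) (N - i.+1)); split.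
    + rewrite mulnS [X in _ <= X]addnC -addnA leq_add // leq_add2r.
      by rewrite (leq_trans le2) //= updE eq_sym v0 S0.
    + apply: steps_trans (steps_trans st st2) _.
      apply: (steps_exec Pk6); apply: (steps_exec Pk7); apply: (steps_exec Pk8).
      apply: (steps_exec Pk9); rewrite /exec !updE !eqxx nv_neq0.
      rewrite (eq_sym 0 v) v0 vnv X30 X3v addn1 subn_gt0 ltn_neqAle leN andbT.
      by rewrite -[(_ + size l1).+4]addn4 /k1; case: (i.+1 == N); apply: steps_refl.
    + apply: (@frame_repr _ 0 (upd X3 v i.+1)).
        by move=> h hh; rewrite !updE; case: eqP => [|_]; [|case: eqP => //]; lia.
      split=> [w ltw|b j ltb]; rewrite updE.
        by case: sX3 => sX3 _; rewrite /= updE sX3.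
      by case: sX3 => _ sX3; rewrite sX3 //; case: eqP => //; rewrite /addr; lia.
  have sizeE : k + (size (l1 ++ [:: RConst (nv + 0) 1; RAdd v v (nv + 0);
      RSub (nv + 0) 0 v; RJump k1 (nv + 0)])).+4 = k1 + size l1 + 4.
    by rewrite size_cat /k1 /=; lia.
  rewrite sizeE; case: (posnP N) => [N_eq0|N_gt0].
    by exists 4, X1; rewrite N_eq0 /= in st1 sX1 *; rewrite muln0; split.
  have [t [X2 [le1 st sX2]]] := loop N N_gt0 (leqnn N).
  rewrite eqxx in st; rewrite eqn0Ngt N_gt0 in st1.
  exists (4 + t), X2; rewrite leq_add2l; split=> //.
  exact: steps_trans st1 st.
Qed.

Lemma halted_iter P s t : halted P s -> iter t (step P) s = s.
Proof.
move=> hs; elim: t => //= t ->; rewrite /step.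
by rewrite onth_default.
Qed.

(** The leading read puts the first input number into register 0 as the loop bound; its single step
    is why the cost must be strictly below [t]. *)
Lemma comp_outputs c N xs t :
  wf c -> 0 < nv -> 2 < nd -> 0 \notin writes c -> cost c N < t ->
  outputs_within (RRead 0 :: comp 1 c) (N :: xs) t
    (out (run c (Store (upd (fun=> 0) 0 N) (fun _ _ => 0) xs [::]))).
Proof.
move=> wfc nv0 nd2 n0c ltt; set P := RRead 0 :: comp 1 c; set s := Store _ _ _ _.
have Pc : code_at P 1 (comp 1 c) by exists [:: RRead 0], [::]; rewrite cats0; split.
have s0 : repr s (upd (fun=> 0) 0 N).
  by split=> // a i lta; rewrite updE; case: eqP => //; rewrite /addr; lia.
have [t1 [X [le1 st sX]]] := compP Pc wfc nv0 nd2 n0c s0.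
have lt1 : t1 < t by rewrite (leq_ltn_trans _ ltt).
rewrite /outputs_within -(subnK lt1) iterD iterSr.
rewrite -[step P (init _)]/(Config 1 (upd (fun=> 0) 0 N) xs [::]) st.
set s' := Config _ _ _ _; have hs : halted P s' by rewrite /halted /= add1n.
by rewrite halted_iter.
Qed.

End Compiler.

(** * The program *)

#[local] Arguments run : simpl never.
#[local] Arguments upd _ _ _ _ /.

Local Notation "c1 ;; c2" := (CSeq c1 c2) (at level 61, right associativity).

Local Notation vV := 1 (only parsing).
Local Notation vT := 2 (only parsing).
Local Notation vLive := 3 (only parsing).
Local Notation vA := 4 (only parsing).
Local Notation vB := 5 (only parsing).
Local Notation vDeg := 6 (only parsing).
Local Notation vS := 7 (only parsing).
Local Notation vU := 8 (only parsing).
Local Notation vP := 9 (only parsing).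
Local Notation vR := 10 (only parsing).
Local Notation vF := 11 (only parsing).
Local Notation vQ := 12 (only parsing).
Local Notation vI := 13 (only parsing).
Local Notation vX := 14 (only parsing).
Local Notation vY := 15 (only parsing).
Local Notation vJ := 16 (only parsing).
Local Notation vW := 17 (only parsing).
Local Notation vOff := 18 (only parsing).
Local Notation vTmp := 19 (only parsing).
Local Notation vK := 20 (only parsing).

Local Notation aAdj := 0 (only parsing).
Local Notation aRow := 1 (only parsing).
Local Notation aCol := 2 (only parsing).
Local Notation aLev := 3 (only parsing).
Local Notation aPar := 4 (only parsing).

(** With truncated subtraction this is the distance of the two values. *)
Definition Eneq (e1 e2 : expr) : expr := EAdd (ESub e1 e2) (ESub e2 e1).
Definition Eeq (e1 e2 : expr) : expr := ESub (ECst 1) (Eneq e1 e2).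
(** The array [aRow] tabulates the row offsets and so avoids multiplications. *)
Definition Eedge (x y : nat) : expr :=
  EArr aAdj (EAdd (EArr aRow (EVar x)) (EVar y)).
Definition Ecol (x : nat) : expr := EArr aCol (EVar x).

Definition c_count : cmd :=
  CFor vS (CIf (Eedge vS vT) (
    CSet vDeg (EAdd (EVar vDeg) (ECst 1)) ;;
    CIf (Eeq (Ecol vS) (ECst 1)) (CSet vA (EAdd (EVar vA) (ECst 1))) ;;
    CIf (Eeq (Ecol vS) (ECst 2)) (CSet vB (EAdd (EVar vB) (ECst 1))))).

Definition c_settle : cmd :=
  CSet vA (ECst 0) ;; CSet vB (ECst 0) ;; CSet vDeg (ECst 0) ;;
  c_count ;;
  CSet vLive (ECst 1) ;;
  CIf (ESub (EVar vDeg) (EAdd (EVar vA) (EVar vA)))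
    (CPut aCol (EVar vT) (ECst 1) ;; CSet vLive (ECst 0)) ;;
  CIf (EVar vLive)
    (CIf (ESub (EVar vDeg) (EAdd (EVar vB) (EVar vB)))
      (CPut aCol (EVar vT) (ECst 2) ;; CSet vLive (ECst 0))).

Definition c_move (e : expr) : cmd :=
  CIf (EVar vLive) (
    CSet vU e ;;
    CPut aCol (EVar vT) (Ecol vU) ;; CPut aCol (EVar vU) (ECst 0) ;;
    CSet vT (EVar vU) ;;
    c_settle).

Definition c_rotate : cmd :=
  CFor vJ (CIf (Eneq (EVar vT) (EVar vR)) (c_move (EArr aPar (EVar vT)))) ;;
  c_move (EVar vP).

Definition c_scan : cmd :=
  CIf (Eeq (EArr aLev (EVar vX)) (EAdd (EVar vI) (ECst 1)))
  (CIf (Eneq (EVar vX) (EVar vP))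
  (CIf (Eedge vX vY)
  (CIf (Eeq (EArr aLev (EVar vY)) (ECst 0))
  (CPut aLev (EVar vY) (EAdd (EVar vI) (ECst 2)) ;;
   CPut aPar (EVar vY) (EVar vX))))).

Definition c_bfs : cmd :=
  CFor vX (CPut aLev (EVar vX) (ECst 0)) ;;
  CPut aLev (EVar vR) (ECst 1) ;;
  CFor vI (CFor vX (CFor vY c_scan)).

Definition c_find : cmd :=
  CFor vW (CIf (Eedge vW vP) (CIf (Eeq (EArr aLev (EVar vW)) (ECst 0))
    (CSet vF (ECst 1) ;; CSet vQ (EVar vW)))).

Definition c_grow : cmd :=
  c_bfs ;;
  CSet vF (ECst 0) ;;
  c_find ;;
  CIf (EVar vF)
    (c_move (EVar vP) ;; CSet vR (EVar vP) ;; CSet vP (EVar vQ)).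

Definition c_pred : cmd := CFor vW (CIf (Eedge vW vV) (CSet vP (EVar vW))).

Definition c_pick : cmd :=
  CFor vW (CIf (Eedge vW vP)
    (CIf (Eneq (Ecol vW) (EArr aCol (EArr aPar (EVar vP))))
      (CSet vQ (EVar vW)))).

(** Colour one vertex: search for the cycle, rotate, make the detour, rotate again. Setting [vQ] to
    0 keeps it a vertex number even if [c_pick] selects nothing. *)
Definition c_vertex : cmd :=
  CSet vT (EVar vV) ;; c_settle ;;
  CSet vR (EVar vV) ;;
  c_pred ;;
  CFor vK c_grow ;;
  c_bfs ;;
  CFor vK c_rotate ;;
  CSet vQ (ECst 0) ;;
  c_pick ;;
  c_move (EVar vQ) ;;
  CFor vK c_rotate.

Definition c_read : cmd :=
  CSet vOff (ECst 0) ;;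
  CFor vX (CPut aRow (EVar vX) (EVar vOff) ;;
    CFor vY (CRead vTmp ;; CPut aAdj (EVar vOff) (EVar vTmp) ;;
             CSet vOff (EAdd (EVar vOff) (ECst 1)))).

Definition c_print : cmd :=
  CSet vA (ECst 0) ;;
  CFor vX (CIf (Eeq (Ecol vX) (ECst 1)) (CSet vA (EAdd (EVar vA) (ECst 1)))) ;;
  CSet vF (ECst 1) ;;
  CIf (ESub (EAdd (EVar vA) (EVar vA)) (EVar 0)) (CSet vF (ECst 2)) ;;
  CFor vX (CPrint (Eeq (Ecol vX) (EVar vF))).

Definition c_main : cmd := c_read ;; CFor vV c_vertex ;; c_print.

Lemma wf_main : wf 21 8 5 c_main.
Proof. by vm_compute. Qed.

Lemma eval_eq s e1 e2 : (0 < eval s (Eeq e1 e2)) = (eval s e1 == eval s e2).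
Proof. by rewrite /=; lia. Qed.

Lemma eval_neq s e1 e2 : (0 < eval s (Eneq e1 e2)) = (eval s e1 != eval s e2).
Proof. by rewrite /=; lia. Qed.

(** * Correctness of the program *)

Section Correctness.
Variables (n : nat) (E : rel nat).
Hypothesis E_lt : forall u v, E u v -> (u < n) && (v < n).
Hypothesis E_asym : forall u v, E u v -> ~~ E v u.

Definition loaded (s : store) : Prop :=
  var s 0 = n /\
  forall u v, u < n -> v < n -> arr s aAdj (arr s aRow u + v) = E u v.

Lemma loaded_eq s s' : var s' 0 = var s 0 -> arr s' aAdj = arr s aAdj ->
  arr s' aRow = arr s aRow -> loaded s -> loaded s'.
Proof. by move=> eq0 eqA eqR [sn sE]; split; rewrite ?eq0 ?eqA ?eqR. Qed.

Lemma loaded_run c s : 0 \notin writes c -> aAdj \notin arr_writes c ->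
  aRow \notin arr_writes c -> loaded s -> loaded (run c s).
Proof. by move=> *; apply: (@loaded_eq s); rewrite ?var_run ?arr_run. Qed.

Lemma eval_edge s x y : loaded s -> var s x < n -> var s y < n ->
  (0 < eval s (Eedge x y)) = E (var s x) (var s y).
Proof. by move=> [_ sE] ltx lty; rewrite /= sE //; case: (E _ _). Qed.

Definition tok (s : store) : token :=
  Token (arr s aCol) (var s vT) (0 < var s vLive).

Lemma count_iotaS (a : pred nat) i : count a (iota 0 i.+1) = count a (iota 0 i) + a i.
Proof. by rewrite -addn1 iotaD count_cat /= addn0. Qed.

Lemma run_count s : loaded s -> var s vT < n ->
  var s vA = 0 -> var s vB = 0 -> var s vDeg = 0 ->
  [/\ var (run c_count s) vA = cnt n E 1 (arr s aCol) (var s vT),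
      var (run c_count s) vB = cnt n E 2 (arr s aCol) (var s vT)
    & var (run c_count s) vDeg = deg n E (var s vT)].
Proof.
move=> sL ltT A0 B0 D0.
pose t := var s vT; pose f := arr s aCol.
pose Q i s' := [/\ var s' vA = count (fun u => E u t && (f u == 1)) (iota 0 i),
  var s' vB = count (fun u => E u t && (f u == 2)) (iota 0 i)
  & var s' vDeg = count (E^~ t) (iota 0 i)].
have sn : var s 0 = n by case: sL.
suff : Q (var s 0) (run c_count s) by rewrite sn.
apply: (@run_for Q) => // i s'; rewrite sn => lti s'i fv fa [QA QB QD].
have s'L : loaded s' by apply: loaded_eq sL; rewrite ?fv ?fa.
rewrite run_if eval_edge // ?s'i ?fv // -/t.
rewrite /Q !count_iotaS -QA -QB -QD; case: (E i t); last by rewrite !addn0.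
rewrite run_seq run_set run_seq [run _ (set_var _ _ _)]run_if eval_eq /= s'i fa //.
rewrite -/f; case: ifP => _; rewrite run_if eval_eq ?run_set /= s'i fa // -/f;
  by case: ifP => _; rewrite ?addn0.
Qed.

Lemma run_settle s : loaded s -> var s vT < n ->
  tok (run c_settle s) = settle n E (arr s aCol) (var s vT).
Proof.
move=> sL ltT; rewrite /c_settle !run_seq ![run (CSet _ _) _]run_set.
set s0 := set_var (set_var _ _ _) _ _.
have s0L : loaded s0 by apply: loaded_eq sL.
have [] := run_count s0L ltT erefl erefl erefl.
have := @var_run c_count s0 vT isT; have := @arr_run c_count s0 aCol isT.
move: (run c_count s0) => s1 /= s1C s1T s1A s1B s1D.
rewrite /settle /tok [run _ (set_var _ _ _)]run_if /= s1A s1D addnn -mul2n subn_gt0.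
case: ifP => lt1.
  by rewrite run_seq run_put run_set run_if /= s1T s1C.
rewrite run_if /= run_if /= s1B s1D addnn -mul2n subn_gt0.
case: ifP => lt2; last by rewrite /= s1C s1T.
by rewrite run_seq run_put run_set /= s1T s1C.
Qed.

Lemma run_move e s : loaded s -> (0 < var s vLive -> eval s e < n) ->
  tok (run (c_move e) s) = move n E (eval s e) (tok s).
Proof.
move=> sL lte; rewrite /c_move run_if /move /=; case: ifP => // /lte {}lte.
rewrite run_seq run_set run_seq run_put run_seq run_put run_seq run_set.
by rewrite run_settle //=; apply: loaded_eq sL.
Qed.

Lemma run_rotate s : loaded s -> (forall y, arr s aPar y < n) ->
  var s vP < n ->
  tok (run c_rotate s) =
    rotate n E (var s vP) (var s vR) (arr s aPar) (tok s).
Proof.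
move=> sL ltP ltp; rewrite /c_rotate run_seq.
set c := CFor _ _; set P := arr s aPar; set r := var s vR.
have sn : var s 0 = n by case: sL.
pose f k := if pos k == r then k else move n E (P (pos k)) k.
pose Q i s' := tok s' = iter i f (tok s).
have QE : Q (var s 0) (run c s).
  apply: (@run_for Q) => // i s' _ _ fv fa Qi.
  rewrite /Q iterS -Qi run_if eval_neq /= (fv vR) // -/r.
  have s'L : loaded s' by apply: loaded_eq sL; rewrite ?fv ?fa.
  have -> : f (tok s') = if var s' vT == r then tok s'
    else move n E (P (var s' vT)) (tok s') by [].
  by rewrite if_neg; case: ifP => // _; rewrite run_move //= fa.
have cL : loaded (run c s) by apply: loaded_run.
rewrite /rotate /descend -[X in iter X]sn -/f.
have pE : var (run c s) vP = var s vP by rewrite var_run.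
by rewrite run_move // [eval _ _]pE // QE.
Qed.

(** What must survive from earlier searches: clearing only reaches the levels below [n], and moves
    to a parent are verified without knowing that the table entry is current. *)
Definition graph_arrays (s : store) : Prop :=
  (forall y, n <= y -> arr s aLev y = 0) /\ (forall y, arr s aPar y < n).

Lemma run_clear s : var s 0 = n -> graph_arrays s ->
  forall y, arr (run (CFor vX (CPut aLev (EVar vX) (ECst 0))) s) aLev y = 0.
Proof.
move=> sn [lev0 _] y; set c := CPut _ _ _.
pose Q i s' := forall y, y < i \/ n <= y -> arr s' aLev y = 0.
have : Q (var s 0) (run (CFor vX c) s).
  apply: (@run_for Q) => //.
    by move=> z [|/lev0].
  move=> i s' _ s'i _ _ Qi z; rewrite run_put /= s'i.
  case: eqVneq => // nzi zi; apply: Qi; lia.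
by rewrite sn; apply; lia.
Qed.

Lemma run_bfs s : loaded s -> graph_arrays s -> var s vR < n ->
  graph_arrays (run c_bfs s) /\
  bfs n E (var s vP) (var s vR) (arr (run c_bfs s) aLev)
    (arr (run c_bfs s) aPar).
Proof.
move=> sL sG ltr; have sn : var s 0 = n by case: sL.
rewrite /c_bfs run_seq; set c0 := CFor vX (CPut _ _ _).
have s1D := run_clear sn sG; rewrite -/c0 in s1D.
have s1L : loaded (run c0 s) by apply: loaded_run.
have s1P : arr (run c0 s) aPar = arr s aPar by rewrite arr_run.
have s1p : var (run c0 s) vP = var s vP by rewrite var_run.
have s1r : var (run c0 s) vR = var s vR by rewrite var_run.
move: (run c0 s) s1D s1L s1P s1p s1r => s1 s1D s1L s1P s1p s1r.
rewrite run_seq run_put; set s2 := set_arr _ _ _ _.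
have s2L : loaded s2 by apply: loaded_eq s1L.
set p := var s vP; set r := var s vR in ltr *.
(* The three nested loops follow the three indices of [scan]; [scan_row] and [scan_level] carry the
   end of an inner loop to the next pass of the outer one. *)
pose Q i x y s' := scan n E p r i x y (arr s' aLev) (arr s' aPar) /\
  (forall y, arr s' aPar y < n).
suff [Qs QP] : Q n 0 0 (run (CFor vI (CFor vX (CFor vY c_scan))) s2).
  have B := scan_bfs Qs; split=> //; split=> // y ley.
  apply/eqP; rewrite -leqn0 leqNgt; apply/negP => /(bfs_lt B).
  by rewrite ltnNge ley.
have s2n : var s2 0 = n by case: s2L.
rewrite -[X in Q X]s2n; apply: (@run_for (fun i => Q i 0 0)) => //.
  split; last by rewrite /= s1P; case: sG.
  apply: scan_init => //= [|z nzr]; first by rewrite s1r eqxx.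
  by rewrite s1r (negbTE nzr) s1D.
move=> i s3; rewrite s2n => lti s3i fv3 fa3 Q3.
have s3n : var s3 0 = n by rewrite fv3.
suff [Qs QP] : Q i n 0 (run (CFor vX (CFor vY c_scan)) s3).
  by split=> //; apply: scan_level.
rewrite -[X in Q _ X]s3n; apply: (@run_for (fun x => Q i x 0)) => //.
move=> x s4; rewrite s3n => ltx s4x fv4 fa4 Q4.
have s4n : var s4 0 = n by rewrite fv4.
suff [Qs QP] : Q i x n (run (CFor vY c_scan) s4) by split=> //; apply: scan_row.
rewrite -[X in Q _ _ X]s4n; apply: (@run_for (fun y => Q i x y)) => //.
move=> y s5; rewrite s4n => lty s5y fv5 fa5 [Qs QP].
have s5L : loaded s5.
  by apply: loaded_eq s2L; rewrite ?fv5 ?fa5 ?fv4 ?fa4 ?fv3 ?fa3.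
have s5x : var s5 vX = x by rewrite fv5.
have s5i : var s5 vI = i by rewrite fv5 ?fv4.
have s5p : var s5 vP = p by rewrite fv5 ?fv4 ?fv3.
rewrite /c_scan run_if eval_eq run_if eval_neq run_if eval_edge ?s5x ?s5y //.
rewrite run_if eval_eq run_seq !run_put /= s5x s5y s5i s5p addn1.
have skip := scan_skip Qs.
case: (eqVneq (arr s5 aLev x) i.+1) skip => [Dx|_]; last by move=> /(_ isT).
case: (eqVneq x p) => [_|nxp]; first by move=> /(_ isT).
case Exy: (E x y); last by move=> /(_ isT).
case: (eqVneq (arr s5 aLev y) 0) => [Dy|_]; last by move=> /(_ isT).
move=> _; split=> [|z]; last by rewrite /=; case: eqP.
have := scan_step E_asym lty Qs; rewrite Dx Dy nxp Exy !eqxx => /(_ isT).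
by rewrite /= ?s5x ?s5y ?s5i ?addn2.
Qed.

(** The edge is maintained even after the hole has disappeared, so the remaining passes still make
    sense. *)
Record searching (U : pred nat) (s : store) : Prop := Searching {
  srch_loaded : loaded s;
  srch_arrays : graph_arrays s;
  srch_edge : E (var s vP) (var s vR);
  srch_inv : inv n E U (tok s);
  srch_pos : live (tok s) -> pos (tok s) = var s vR }.

(** Either the search for the cycle is over or at least [i] vertices are reached. The tables are
    quantified because those in memory are outdated once [vP] and [vR] have changed. *)
Definition in_reached_or (i : nat) (s : store) : Prop :=
  forall D P, bfs n E (var s vP) (var s vR) D P ->
    (forall q, E q (var s vP) -> 0 < D q) \/ i <= reached n (var s vP) D.

Lemma run_find s : loaded s -> var s vP < n -> var s vF = 0 ->
  if 0 < var (run c_find s) vF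
  then E (var (run c_find s) vQ) (var s vP) /\
       arr s aLev (var (run c_find s) vQ) = 0
  else forall q, E q (var s vP) -> 0 < arr s aLev q.
Proof.
move=> sL ltp F0; have sn : var s 0 = n by case: sL.
pose Q i s' := if 0 < var s' vF
  then E (var s' vQ) (var s vP) /\ arr s aLev (var s' vQ) = 0
  else forall q, q < i -> E q (var s vP) -> 0 < arr s aLev q.
have : Q (var s 0) (run c_find s).
  apply: (@run_for Q) => //; first by rewrite /Q F0.
  move=> i s'; rewrite sn => lti s'i fv fa.
  have s'L : loaded s' by apply: loaded_eq sL; rewrite ?fv ?fa.
  have s'p : var s' vP = var s vP by rewrite fv.
  rewrite /Q run_if eval_edge ?s'i ?s'p // run_if eval_eq /= s'i fa //.
  case Eip: (E i _); last first.
    case: ifP => // _ H q; rewrite ltnS leq_eqVlt => /predU1P[->|]; last exact: H.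
    by rewrite Eip.
  case: eqP => [Di _|/eqP Di]; first by rewrite run_seq !run_set /= s'i.
  case: ifP => // _ H q; rewrite ltnS leq_eqVlt => /predU1P[-> _|]; last exact: H.
  by rewrite lt0n.
rewrite /Q sn; case: ifP => // _ H q Eqp; apply: H => //.
by case/andP: (E_lt Eqp).
Qed.

Lemma run_grow U s : searching U s -> searching U (run c_grow s) /\
  forall i, in_reached_or i s -> in_reached_or i.+1 (run c_grow s).
Proof.
move=> [sL sG Epr sI sP]; have /andP[ltp ltr] := E_lt Epr.
rewrite /c_grow run_seq.
have [s1G B] := run_bfs sL sG ltr.
have s1L : loaded (run c_bfs s) by apply: loaded_run.
have s1p : var (run c_bfs s) vP = var s vP by rewrite var_run.
have s1r : var (run c_bfs s) vR = var s vR by rewrite var_run.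
have s1T : tok (run c_bfs s) = tok s by rewrite /tok arr_run // !var_run.
move: (run c_bfs s) s1G B s1L s1p s1r s1T => s1 s1G B s1L s1p s1r s1T.
rewrite run_seq run_set run_seq; set s2 := set_var _ _ _.
have s2L : loaded s2 by apply: loaded_eq s1L.
have s2p : var s2 vP = var s vP by [].
have ltp2 : var s2 vP < n by rewrite s2p.
have := run_find s2L ltp2 erefl; rewrite s2p.
have s3L : loaded (run c_find s2) by apply: loaded_run.
have s3p : var (run c_find s2) vP = var s vP by rewrite var_run.
have s3r : var (run c_find s2) vR = var s vR by rewrite var_run.
have s3T : tok (run c_find s2) = tok s by rewrite /tok arr_run // !var_run.
have s3G : graph_arrays (run c_find s2) by rewrite /graph_arrays !arr_run.
move: (run c_find s2) s3L s3p s3r s3T s3G => s3 s3L s3p s3r s3T s3G.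
rewrite run_if [eval _ _]/=; case: (0 < _) => [[Eqp Dq]|Dq]; last first.
  split; first by split; rewrite ?s3p ?s3r ?s3T.
  move=> i _ D' P'; rewrite s3p s3r => B'; left=> q /Dq.
  exact: (bfs_reached B B').
rewrite run_seq run_seq !run_set.
have s4T := @run_move (EVar vP) s3 s3L (fun _ => ltac:(by rewrite /= s3p)).
rewrite [eval _ _]/= s3p s3T in s4T.
have s4L : loaded (run (c_move (EVar vP)) s3) by apply: loaded_run.
have s4p : var (run (c_move (EVar vP)) s3) vP = var s vP by rewrite var_run.
have s4q : var (run (c_move (EVar vP)) s3) vQ = var s3 vQ by rewrite var_run.
have s4G : graph_arrays (run (c_move (EVar vP)) s3).
  by rewrite /graph_arrays !arr_run.
move: (run (c_move _) s3) s4T s4L s4p s4q s4G => s4 s4T s4L s4p s4q s4G.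
set s5 := set_var _ vP _.
have s5T : tok s5 = move n E (var s vP) (tok s) by rewrite -s4T.
have s5p : var s5 vP = var s3 vQ by rewrite -s4q.
have s5r : var s5 vR = var s vP by rewrite -s4p.
have s5L : loaded s5 by apply: loaded_eq s4L.
split.
  split; rewrite ?s5p ?s5r ?s5T //.
  - by apply: move_inv => // /sP ->.
  - by case/live_move.
(* The unreached [q] excludes that the search was over, so the count was at least [i] and now
   grows. *)
move=> i iH D' P'; rewrite s5p s5r => B'; right.
case: (iH _ _ B) => [/(_ _ Eqp)|lei]; first by rewrite Dq.
exact: leq_ltn_trans lei (reached_grow E_lt E_asym B B' Epr Eqp Dq).
Qed.

Lemma run_rotations s : loaded s -> (forall y, arr s aPar y < n) ->
  var s vP < n ->
  tok (run (CFor vK c_rotate) s) =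
    iter n (rotate n E (var s vP) (var s vR) (arr s aPar)) (tok s).
Proof.
move=> sL ltP ltp; have sn : var s 0 = n by case: sL.
set f := rotate _ _ _ _ _; rewrite -[X in iter X]sn.
pose Q i s' := tok s' = iter i f (tok s).
apply: (@run_for Q) => // i s' _ _ fv fa Qi; rewrite /Q iterS -Qi.
by rewrite run_rotate ?fv ?fa //; apply: loaded_eq sL; rewrite ?fv ?fa.
Qed.

Hypothesis E_in : forall v, v < n -> exists u, E u v.

Lemma run_pred s : loaded s -> var s vV < n ->
  E (var (run c_pred s) vP) (var s vV).
Proof.
move=> sL ltv; have sn : var s 0 = n by case: sL.
pose Q i s' := E (var s' vP) (var s vV) \/ forall w, w < i -> ~~ E w (var s vV).
have : Q (var s 0) (run c_pred s).
  apply: (@run_for Q) => //; first by right.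
  move=> i s'; rewrite sn => lti s'i fv fa.
  have s'L : loaded s' by apply: loaded_eq sL; rewrite ?fv ?fa.
  have s'v : var s' vV = var s vV by rewrite fv.
  rewrite /Q run_if eval_edge ?s'i ?s'v //.
  case Eiv: (E i (var s vV)); first by move=> _; left; rewrite run_set /= s'i.
  case=> [H|H]; first by left.
  right=> w; rewrite ltnS leq_eqVlt => /predU1P[->|]; last exact: H.
  by rewrite Eiv.
case=> //; rewrite sn => H; have [u Eu] := E_in ltv.
by have /andP[/H /negP] := E_lt Eu.
Qed.

Lemma run_pick s : loaded s -> graph_arrays s -> var s vP < n -> var s vQ < n ->
  let q := var (run c_pick s) vQ in
  let c := arr s aCol (arr s aPar (var s vP)) in
  q < n /\ ((exists2 w, E w (var s vP) & arr s aCol w != c) ->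
    E q (var s vP) /\ arr s aCol q != c).
Proof.
move=> sL sG ltp ltq q c; have sn : var s 0 = n by case: sL.
pose Q i s' := var s' vQ < n /\
  (E (var s' vQ) (var s vP) /\ arr s aCol (var s' vQ) != c \/
   forall w, w < i -> E w (var s vP) -> arr s aCol w = c).
have : Q (var s 0) (run c_pick s).
  apply: (@run_for Q) => //; first by split=> //; right.
  move=> i s'; rewrite sn => lti s'i fv fa [ltq' H].
  have s'L : loaded s' by apply: loaded_eq sL; rewrite ?fv ?fa.
  have s'p : var s' vP = var s vP by rewrite fv.
  rewrite /Q run_if eval_edge ?s'i ?s'p // run_if eval_neq /= s'i s'p !fa // -/c.
  have next : (E i (var s vP) -> arr s aCol i = c) ->
      (forall w, w < i -> E w (var s vP) -> arr s aCol w = c) ->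
      forall w, w < i.+1 -> E w (var s vP) -> arr s aCol w = c.
    by move=> Hi Hw w; rewrite ltnS leq_eqVlt => /predU1P[->|/Hw].
  case Ei: (E i _); last first.
    by split=> //; case: H => [|H]; [left | right; apply: next => //; rewrite Ei].
  rewrite if_neg; case: (eqVneq (arr s aCol i) c) => [ci|ci]; last first.
    by rewrite run_set /= s'i; split=> //; left.
  by split=> //; case: H => [|H]; [left | right; apply: next].
rewrite /Q sn -/q => -[ltq' H]; split=> // -[w Ewp wc].
case: H => // /(_ w) H; rewrite H ?eqxx // in wc.
by case/andP: (E_lt Ewp).
Qed.

Record coloured (v : nat) (f : nat -> nat) : Prop := Coloured {
  clr_valid : valid n E f;
  clr_le2 : forall u, u < n -> f u <= 2;
  clr_col : forall u, u < n -> (f u == 0) = (v <= u) }.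

Lemma run_vertex s v : loaded s -> graph_arrays s -> var s vV = v -> v < n ->
  coloured v (arr s aCol) ->
  graph_arrays (run c_vertex s) /\ coloured v.+1 (arr (run c_vertex s) aCol).
Proof.
move=> sL sG sv ltv [cV c2 c0]; pose U u := u < v.+1.
have n_gt0 : 0 < n by apply: leq_ltn_trans ltv.
rewrite /c_vertex run_seq run_set run_seq; set s0 := set_var _ _ _.
have s0L : loaded s0 by apply: loaded_eq sL.
have lt0 : var s0 vT < n by rewrite /= sv.
have s1T := run_settle s0L lt0; rewrite [arr s0 _]/= [var s0 _]/= sv in s1T.
have s1I : inv n E U (tok (run c_settle s0)).
  rewrite s1T; apply: settle_inv => //; last exact: ltnSn.
  move=> u ltu; rewrite c0 // /U ltnS -ltnNge leq_eqVlt eq_sym orbC.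
  by [].
have s1P : live (tok (run c_settle s0)) -> pos (tok (run c_settle s0)) = v.
  by rewrite s1T => /live_settle ->.
have s1L : loaded (run c_settle s0) by apply: loaded_run.
have s1v : var (run c_settle s0) vV = v by rewrite var_run.
have s1G : graph_arrays (run c_settle s0) by rewrite /graph_arrays !arr_run.
move: (run c_settle s0) s1I s1P s1L s1v s1G => s1 s1I s1P s1L s1v s1G {s1T}.
rewrite run_seq run_set run_seq; set s2 := set_var _ _ _.
have s2L : loaded s2 by apply: loaded_eq s1L.
have s2v : var s2 vV = v by [].
have lt2 : var s2 vV < n by rewrite s2v.
have s3E := run_pred s2L lt2; rewrite s2v in s3E.
have s3 : searching U (run c_pred s2).
  have s3r : var (run c_pred s2) vR = v by rewrite var_run.
  have s3T : tok (run c_pred s2) = tok s1 by rewrite /tok arr_run // !var_run.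
  split; rewrite ?s3r ?s3T //; first exact: loaded_run.
  by rewrite /graph_arrays !arr_run.
move: (run c_pred s2) s3 {s3E} => s3 s3S.
rewrite run_seq; set c := CFor vK c_grow.
have : searching U (run c s3) /\ in_reached_or n (run c s3).
  have s3n : var s3 0 = n by case: (srch_loaded s3S).
  pose Q i s' := searching U s' /\ in_reached_or i s'.
  suff : Q (var s3 0) (run c s3) by rewrite s3n.
  apply: (@run_for Q) => // [i s' k [[L G Es I Ps] R]||].
  - by split; [split=> //; apply: loaded_eq L|].
  - by split=> // D P _; right.
  move=> i s' _ _ _ _ [s'S s'R]; have [s'S' s'R'] := run_grow s'S.
  by split=> //; apply: s'R'.
move: (run c s3) => s4 {c s3S} [[s4L s4G s4E s4I s4P] s4R].
have /andP[ltp ltr] := E_lt s4E.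
rewrite run_seq; have [s5G B] := run_bfs s4L s4G ltr.
have s5L : loaded (run c_bfs s4) by apply: loaded_run.
have s5p : var (run c_bfs s4) vP = var s4 vP by rewrite var_run.
have s5r : var (run c_bfs s4) vR = var s4 vR by rewrite var_run.
have s5T : tok (run c_bfs s4) = tok s4 by rewrite /tok arr_run // !var_run.
(* After [n] passes the other alternative, [n] reached vertices besides [p], is impossible. *)
have in_reached : forall q, E q (var s4 vP) -> 0 < arr (run c_bfs s4) aLev q.
  by case: (s4R _ _ B) => //; rewrite leqNgt reached_lt.
move: (run c_bfs s4) s5G s5L s5p s5r s5T B in_reached.
move=> s5 s5G s5L s5p s5r s5T B in_reached.
have in_p := E_in ltp.
set p := var s4 vP in s4E ltp s5p B in_reached in_p *.
set r := var s4 vR in s4E ltr s5r B s4P *.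
set D := arr s5 aLev in B in_reached; set P := arr s5 aPar in B.
have ltP y : P y < n by case: s5G.
have [s6I s6P] := rotations_mono E_lt E_asym B s4E in_reached in_p s4I s4P.
have s6T := run_rotations s5L ltP; rewrite s5p s5r s5T in s6T.
rewrite -(s6T ltp) in s6I s6P; rewrite run_seq; set c := CFor vK c_rotate.
rewrite -/c in s6I s6P.
have s6L : loaded (run c s5) by apply: loaded_run.
have s6G : graph_arrays (run c s5) by rewrite /graph_arrays !arr_run.
have s6p : var (run c s5) vP = p by rewrite var_run.
have s6r : var (run c s5) vR = r by rewrite var_run.
have s6Par : arr (run c s5) aPar = P by rewrite arr_run.
move: (run c s5) s6I s6P s6L s6G s6p s6r s6Par {s6T}.
move=> s6 s6I s6P s6L s6G s6p s6r s6Par.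
rewrite run_seq run_set run_seq; set s7 := set_var _ _ _.
have s7L : loaded s7 by apply: loaded_eq s6L.
have s7p : var s7 vP < n by rewrite /= s6p.
have := run_pick s7L s6G s7p n_gt0.
rewrite [var s7 _]s6p [arr s7 aCol]/= [arr s7 aPar]s6Par => -[].
have s8T : tok (run c_pick s7) = tok s6 by rewrite /tok arr_run // !var_run.
have s8L : loaded (run c_pick s7) by apply: loaded_run.
have s8G : graph_arrays (run c_pick s7) by rewrite /graph_arrays !arr_run.
have s8p : var (run c_pick s7) vP = p by rewrite var_run.
have s8r : var (run c_pick s7) vR = r by rewrite var_run.
have s8Par : arr (run c_pick s7) aPar = P by rewrite arr_run.
move: (run c_pick s7) s8T s8L s8G s8p s8r s8Par.
move=> s8 s8T s8L s8G s8p s8r s8Par ltq pick.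
set q := var s8 vQ in ltq pick.
have [|s9I s9D] := @rotations_dead n E E_lt E_asym p r D P B s4E in_reached
  in_p U (tok s6) q s6I.
  move=> lv; have [posp mono] := s6P lv.
  (* A balanced vertex with an in-neighbour sees both colours, so one of [w1] and [w2] differs in
     colour from [P p]. *)
  have [w Ew] := in_p; have Ew' : E w (pos (tok s6)) by rewrite posp.
  have [w1 Ew1 cw1] := @live_has_col _ _ E_lt _ _ w 1 s6I lv Ew' isT.
  have [w2 Ew2 cw2] := @live_has_col _ _ E_lt _ _ w 2 s6I lv Ew' isT.
  rewrite posp in Ew1 Ew2.
  have [|Eq cq] := pick; last by split.
  case: (eqVneq (arr s6 aCol (P p)) 1) => [->|n1]; [exists w2 | exists w1] => //.
    by rewrite [arr s6 aCol w2]cw2.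
  by rewrite [arr s6 aCol w1]cw1 eq_sym.
rewrite run_seq; have s9T := @run_move (EVar vQ) s8 s8L (fun _ => ltq).
have s9L : loaded (run (c_move (EVar vQ)) s8) by apply: loaded_run.
have s9G : graph_arrays (run (c_move (EVar vQ)) s8).
  by rewrite /graph_arrays !arr_run.
have s9p : var (run (c_move (EVar vQ)) s8) vP = p by rewrite var_run.
have s9r : var (run (c_move (EVar vQ)) s8) vR = r by rewrite var_run.
have s9Par : arr (run (c_move (EVar vQ)) s8) aPar = P by rewrite arr_run.
move: (run _ s8) s9T s9L s9G s9p s9r s9Par => s9 s9T s9L s9G s9p s9r s9Par.
have := run_rotations s9L; rewrite s9p s9r s9Par => /(_ ltP ltp).
rewrite s9T s8T -/c => s10T; rewrite -s10T in s9I s9D.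
split; first by rewrite /graph_arrays !arr_run.
split; first exact: (inv_valid s9I).
- by move=> u /(inv_le2 s9I).
- move=> u ltu; have := inv_col s9I ltu; rewrite (negbTE s9D) orbF /= => ->.
  by rewrite -leqNgt.
Qed.

Definition adjacency (i j : nat) : seq nat :=
  [seq nat_of_bool (E u v) | u <- iota i j, v <- iota 0 n].

Lemma adjacency_cons i j :
  adjacency i j.+1 = [seq nat_of_bool (E i v) | v <- iota 0 n] ++ adjacency i.+1 j.
Proof. by []. Qed.

Definition cells (m : nat) (s : store) : Prop :=
  forall k, k < m -> arr s aAdj k = E (k %/ n) (k %% n).

Lemma run_read s : var s 0 = n -> inp s = adjacency 0 n -> loaded (run c_read s).
Proof.
move=> sn s_in; rewrite /c_read run_seq run_set; set s0 := set_var _ _ _.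
pose Q i s' := [/\ inp s' = adjacency i (n - i), var s' vOff = i * n,
  forall u, u < i -> arr s' aRow u = u * n & cells (i * n) s'].
set row := CFor vY _.
set c := CFor vX _; have s0n : var s0 0 = n by [].
suff : Q (var s0 0) (run c s0).
  rewrite s0n => -[_ _ rowE cellE]; split; first by rewrite var_run.
  move=> u v ltu ltv; rewrite rowE // cellE; last by nia.
  by rewrite divnMDl ?modnMDl ?divn_small ?modn_small ?addn0 //; lia.
apply: (@run_for Q) => //.
  by split; rewrite ?subn0 // => k; rewrite mul0n.
move=> i s'; rewrite s0n => lti s'i fv fa [s'in s'off s'row s'cells].
rewrite run_seq run_put; set s1 := set_arr _ _ _ _.
have s1n : var s1 0 = n by rewrite /= fv.
pose Q1 j s' := [/\ inp s' = [seq nat_of_bool (E i v) | v <- iota j (n - j)] ++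
                      adjacency i.+1 (n - i.+1),
  var s' vOff = i * n + j & cells (i * n + j) s'].
have : Q1 (var s1 0) (run row s1).
  apply: (@run_for Q1) => //.
    split; rewrite ?subn0 ?addn0 //.
    by rewrite [inp s1]s'in -adjacency_cons subnSK.
  move=> j s2; rewrite s1n => ltj s2j fv2 fa2 [s2in s2off s2cells].
  rewrite run_seq run_seq run_put run_set; split.
  - by rewrite /run /= s2in -(subnSK ltj) /=.
  - by rewrite /run /= s2off addn1 addnS.
  - move=> k; rewrite addnS ltnS /run /= s2off s2in -(subnSK ltj) /= => lek.
    case: eqVneq => [->|nk]; last by apply: s2cells; lia.
    by rewrite divnMDl ?modnMDl ?divn_small ?modn_small ?addn0 //; lia.
rewrite s1n => -[s3in s3off s3cells]; split.
- by rewrite s3in subnn.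
- by rewrite s3off mulSn addnC.
- move=> u; rewrite arr_run // ltnS leq_eqVlt /= s'i => /predU1P[->|ltu].
    by rewrite eqxx s'off.
  by rewrite (ltn_eqF ltu) s'row.
- by rewrite mulSn addnC.
Qed.

Lemma run_print s : var s 0 = n -> out s = [::] ->
  exists c, [/\ 0 < c <= 2,
    out (run c_print s) = [seq nat_of_bool (arr s aCol u == c) | u <- iota 0 n]
    & 2 * count (fun u => arr s aCol u == c) (iota 0 n) <= n].
Proof.
move=> sn s_out; rewrite /c_print run_seq run_set; set s0 := set_var _ _ _.
rewrite run_seq; set c := CFor vX (CIf _ _); set f := arr s aCol.
pose cnt1 i := count (fun u => f u == 1) (iota 0 i).
have s1A : var (run c s0) vA = cnt1 n.
  have s0n : var s0 0 = n by [].
  pose Q i s' := var s' vA = cnt1 i.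
  suff : Q (var s0 0) (run c s0) by rewrite s0n.
  apply: (@run_for Q) => // i s' _ s'i _ fa Qi.
  rewrite /Q /cnt1 count_iotaS -/(cnt1 i) -Qi run_if eval_eq /= s'i fa //.
  rewrite [arr s0 aCol]/= -/f.
  by case: (f i == 1); rewrite ?addn0.
have s1n : var (run c s0) 0 = n by rewrite var_run.
have s1f : arr (run c s0) aCol = f by rewrite arr_run.
have s1o : out (run c s0) = [::] by rewrite out_run.
move: (run c s0) s1A s1n s1f s1o => s1 s1A s1n s1f s1o {c}.
rewrite run_seq run_set run_seq run_if [eval _ _]/= s1A s1n run_set.
set s2 := if _ then _ else _.
(* Colour 2 is chosen only if colour 1 covers more than half; the class of colour 2, being disjoint
   from it, is then small enough. *)
pose k := if 0 < cnt1 n + cnt1 n - n then 2 else 1.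
have [s2k s2n s2f s2o] : [/\ var s2 vF = k, var s2 0 = n, arr s2 aCol = f
    & out s2 = [::]] by rewrite /s2 /k; case: ifP.
exists k; split.
- by rewrite /k; case: ifP.
- set c := CFor vX _.
  pose Q i s' := out s' = [seq nat_of_bool (f u == k) | u <- iota 0 i].
  suff : Q (var s2 0) (run c s2) by rewrite s2n.
  apply: (@run_for Q) => // i s' _ s'i fv fa Qi.
  rewrite /Q -[i.+1]addn1 iotaD map_cat -[map _ (iota 0 i)]Qi /= cats1.
  congr (rcons _ _); rewrite s'i fa // fv // s2k s2f.
  by rewrite ?add0n; lia.
- have disj : cnt1 n + count (fun u => f u == 2) (iota 0 n) <= n.
    rewrite -[X in _ <= X](size_iota 0 n) /cnt1.
    by elim: (iota 0 n) => //= u l IHl; case: (f u) => [|[|[|m]]] /=; lia.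
  by rewrite /k; case: ifP => /=; rewrite -/(cnt1 n); lia.
Qed.

Hypothesis n_gt0 : 0 < n.

Lemma run_main s : var s 0 = n -> inp s = adjacency 0 n -> out s = [::] ->
  (forall a i, arr s a i = 0) ->
  exists f c, [/\ coloured n f, 0 < c <= 2,
    out (run c_main s) = [seq nat_of_bool (f u == c) | u <- iota 0 n]
    & 2 * count (fun u => f u == c) (iota 0 n) <= n].
Proof.
move=> sn s_in s_out s0; rewrite /c_main run_seq.
have s1L := run_read sn s_in.
have s1G : graph_arrays (run c_read s).
  by split=> y; rewrite arr_run // s0.
have s1C : coloured 0 (arr (run c_read s) aCol).
  rewrite arr_run //; split=> [c X c_gt0 Xc [x Xx]|u _|u _]; rewrite ?s0 //.
  by have [_ x0] := Xc x Xx; rewrite -x0 s0 in c_gt0.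
have s1o : out (run c_read s) = [::] by rewrite out_run.
move: (run c_read s) s1L s1G s1C s1o => s1 s1L s1G s1C s1o {s sn s_in s_out s0}.
have s1n : var s1 0 = n by case: s1L.
rewrite run_seq; set c := CFor vV _.
have s2C : coloured n (arr (run c s1) aCol).
  pose Q i s' := graph_arrays s' /\ coloured i (arr s' aCol).
  suff : Q (var s1 0) (run c s1) by rewrite s1n => -[].
  apply: (@run_for Q) => // i s'; rewrite s1n => lti s'i fv fa [s'G s'C].
  apply: run_vertex => //.
  by apply: loaded_eq s1L; rewrite ?fv ?fa.
have s2n : var (run c s1) 0 = n by rewrite var_run.
have s2o : out (run c s1) = [::] by rewrite out_run.
have [k [k12 outE le]] := run_print s2n s2o.
by exists (arr (run c s1) aCol), k.
Qed.

End Correctness.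

(** * From vertices to ranks *)

Section Ranks.
Variables (T : finType) (e : rel T).

Definition rank (u : T) : nat := index u (enum T).

Definition rank_rel : rel nat := fun i j =>
  [exists u, exists v, [&& rank u == i, rank v == j & e u v]].

Lemma rank_lt u : rank u < #|T|.
Proof. by rewrite /rank cardE index_mem mem_enum. Qed.

Lemma rank_inj : injective rank.
Proof. by move=> u v; apply: index_inj; rewrite ?mem_enum. Qed.

Lemma rank_surj i : i < #|T| -> exists u, rank u = i.
Proof.
rewrite cardE => lti; have [x _] : exists x : T, x \in enum T.
  by case: (enum T) lti => // x s _; exists x; rewrite mem_head.
by exists (nth x (enum T) i); rewrite /rank index_uniq ?enum_uniq.
Qed.

Lemma rank_relE u v : rank_rel (rank u) (rank v) = e u v.
Proof.
apply/existsP/idP => [[u' /existsP[v' /and3P[/eqP/rank_inj-> /eqP/rank_inj->]]] //|euv].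
by exists u; apply/existsP; exists v; rewrite !eqxx.
Qed.

Lemma rank_rel_lt i j : rank_rel i j -> (i < #|T|) && (j < #|T|).
Proof.
by case/existsP=> u /existsP[v /and3P[/eqP<- /eqP<- _]]; rewrite !rank_lt.
Qed.

Lemma map_rank : [seq rank u | u <- enum T] = iota 0 #|T|.
Proof.
rewrite cardE; case En: (enum T) => [//|x0 s0]; rewrite -En.
apply: (@eq_from_nth _ 0); rewrite size_map ?size_iota // => i lti.
by rewrite (nth_map x0) // nth_iota // /rank index_uniq ?enum_uniq.
Qed.

Lemma map_iota_rank (S : Type) (g : nat -> S) :
  [seq g i | i <- iota 0 #|T|] = [seq g (rank u) | u <- enum T].
Proof. by rewrite -map_rank -map_comp. Qed.

Lemma count_rank (a : pred nat) :
  count a (iota 0 #|T|) = #|[set u | a (rank u)]|.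
Proof.
rewrite -map_rank count_map -sum1_count big_enum_cond -sum1_card.
by apply: eq_bigl => u; rewrite inE.
Qed.

Lemma digraph_codeE : digraph_code e = #|T| :: adjacency #|T| rank_rel 0 #|T|.
Proof.
rewrite /digraph_code /adjacency -map_rank allpairs_mapl allpairs_mapr.
congr (_ :: _); apply: eq_allpairs => u v; by rewrite rank_relE.
Qed.

End Ranks.

(** * From colourings to dynamic monopolies *)

(** Activate in rounds starting from [M]. As long as some vertices are inactive, the hypothesis
    applied to the set of all of them yields one that is activated in the next round. *)
Lemma strict_majority_dynamoP (T : finType) (e : rel T) (M : {set T}) :
  (forall X : {set T}, X != set0 -> X \subset ~: M ->
     exists2 x, x \in X & 2 * #|[set u in X | e u x]| < indeg e x) ->
  strict_majority_dynamo e M.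
Proof.
move=> escape.
pose act (S : {set T}) :=
  S :|: [set v | strict_majority e v <= #|[set u in S | e u v]|].
pose S i := iter i act M.
have S_mono i j : i <= j -> S i \subset S j.
  move/subnK <-; elim: (j - i) => // d IHd; apply: subset_trans IHd _.
  exact: subsetUl.
have S_card i : S i = setT \/ i <= #|S i|.
  elim: i => [|i [IHi|IHi]]; first by right.
    by left; apply/eqP; rewrite eqEsubset subsetT -IHi S_mono.
  case: (eqVneq (S i) setT) => [SiT|nT].
    by left; apply/eqP; rewrite eqEsubset subsetT -SiT S_mono.
  right; apply: leq_ltn_trans IHi (proper_card _).
  have [||x] := escape (~: S i).
  - by apply: contraNneq nT => /(congr1 (@setC T)); rewrite setCK setC0 => ->.
  - by rewrite setCS (S_mono 0).
  rewrite inE => xS lt_x; apply/properP; split; first exact: S_mono.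
  exists x => //; have -> : S i.+1 = act (S i) by [].
  rewrite in_setU in_set; apply/orP; right.
  (* Fewer than half of the in-neighbours are inactive, so the active ones form a strict
     majority. *)
  have : indeg e x = #|[set u in S i | e u x]| + #|[set u in ~: S i | e u x]|.
    rewrite /indeg -(cardsID (S i) [set u | e u x]); congr (_ + _);
      apply: eq_card => u.
      by rewrite !inE andbC.
    by rewrite !inE andbC.
  by rewrite /strict_majority; lia.
have S_T : S #|T| = setT.
  have [//|le] := S_card #|T|; apply/eqP.
  by rewrite eqEcard subsetT cardsT.
(* Class [i] consists of the vertices activated in round [i]; late classes may be empty. *)
pose D (i : 'I_#|T|.+1) : {set T} := if i == 0 :> nat then M else S i :\: S i.-1.
have D_sub i : D i \subset S i.
  by rewrite /D; case: eqP => [->|_]; [apply: subxx | apply: subsetDl].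
have bigD (i : nat) : i < #|T|.+1 ->
    S i \subset \bigcup_(j < #|T|.+1 | j <= i) D j.
  elim: i => [|i IHi] lti.
    by apply: (bigcup_max ord0) => //; rewrite /D /= subxx.
  apply/subsetP => v; case vS: (v \in S i) => vS1.
    have /bigcupP[j lej vj] := subsetP (IHi (ltnW lti)) v vS.
    by apply/bigcupP; exists j; rewrite // leqW.
  apply/bigcupP; exists (Ordinal lti) => //.
  by have -> : D (Ordinal lti) = S i.+1 :\: S i by []; rewrite in_setD vS.
exists #|T|, D; split.
- by [].
- apply/eqP; rewrite eqEsubset subsetT -S_T.
  apply: subset_trans (bigD _ (ltnSn _)) _; apply/bigcupsP => j _.
  exact: bigcup_sup.
- move=> i j nij.
  wlog lt_ij: i j nij / i < j.
    move=> W; case: (ltngtP i j) => [lt|gt|/val_inj eq_ij].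
    + exact: W.
    + by rewrite disjoint_sym W // eq_sym.
    + by rewrite eq_ij eqxx in nij.
  rewrite -setI_eq0 -subset0; apply/subsetP => v; rewrite inE => /andP[vi].
  have vS := subsetP (D_sub i) v vi.
  rewrite /D (gtn_eqF (leq_ltn_trans (leq0n _) lt_ij)) inE => /andP[/negP[]].
  by apply: (subsetP (S_mono i j.-1 _)) => //; lia.
- move=> i v i_gt0; rewrite {1}/D (gtn_eqF i_gt0) inE => /andP[vn].
  have -> : S i = act (S i.-1) by rewrite -[in LHS](prednK i_gt0).
  rewrite inE (negbTE vn) inE => /leq_trans; apply; apply: subset_leq_card.
  have lti : i.-1 < #|T|.+1 by have := ltn_ord i; lia.
  apply/subsetP => u; rewrite !inE => /andP[uS ->]; rewrite andbT.
  have /bigcupP[j lej uj] := subsetP (bigD _ lti) u uS.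
  by apply/bigcupP; exists j => //; lia.
Qed.

Lemma size_adjacency n E i j : size (adjacency n E i j) = j * n.
Proof. by rewrite size_allpairs !size_iota. Qed.

(** All vertices outside the class of [c] have the colour [3 - c], so a set avoiding this class is
    monochromatic and validity applies to it. *)
Lemma valid_dynamo (T : finType) (e : rel T) f c :
  coloured #|T| (rank_rel e) #|T| f -> 0 < c <= 2 ->
  strict_majority_dynamo e [set u | f (rank u) == c].
Proof.
move=> [fV f2 f0] c12; apply: strict_majority_dynamoP => X X0 Xsub.
pose X' i := [exists u in X, rank u == i].
have XE u : X' (rank u) = (u \in X).
  apply/existsP/idP => [[w /andP[Xw /eqP/rank_inj <-]] //|Xu].
  by exists u; rewrite Xu eqxx.
have [|||x /existsP[u /andP[Xu /eqP<-]]] := fV (3 - c) X'; first lia.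
- move=> x /existsP[u /andP[Xu /eqP<-]]; split; first exact: rank_lt.
  have := f0 _ (rank_lt u); rewrite leqNgt rank_lt.
  have := f2 _ (rank_lt u); have := subsetP Xsub u Xu; rewrite !inE.
  by case: (f _) => [|[|[|?]]] //; move: c12; clear; case: c => [|[|[|?]]].
- by have /set0Pn[u Xu] := X0; exists (rank u); rewrite XE.
rewrite /deg !count_rank => lt_u; exists u => //.
have -> : indeg e u = #|[set w : T | rank_rel e (rank w) (rank u)]|.
  by apply: eq_card => w; rewrite !inE rank_relE.
apply: leq_ltn_trans lt_u; rewrite leq_mul2l /=; apply: subset_leq_card.
by apply/subsetP => w; rewrite !inE rank_relE XE andbC.
Qed.

Theorem mainTheorem4 :
  exists (P : program) (p : {poly nat}),
    forall (T : finType) (e : rel T),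
      simple_digraph e -> (forall v : T, 0 < indeg e v) ->
      exists M : {set T},
        [/\ outputs_within P (digraph_code e)
              (p.[size (digraph_code e)])%R (vset_code M),
            strict_majority_dynamo e M
          & 2 * #|M| <= #|T| ].
Proof.
exists (RRead 0 :: comp 21 8 5 1 c_main), (cost_poly 21 8 5 c_main + 1%N%:P)%R.
move=> T e [_ e_asym] e_in; rewrite digraph_codeE.
set n := #|T|; set E := rank_rel e; set s0 := n :: _.
(* The code of the graph has length [n * n + 1], which is at least [n]; the added 1 pays for the
   initial read. *)
have cost_lt : cost 21 8 5 c_main n <
    ((cost_poly 21 8 5 c_main + 1%N%:P).[size s0])%R.
  rewrite hornerD hornerC horner_cost_poly [X in _ < X]addn1 ltnS leq_cost //.
  by rewrite /s0 /= size_adjacency; nia.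
have prints := comp_outputs (adjacency n E 0 n) wf_main isT isT isT cost_lt.
(* With no vertices the bound on parents in [graph_arrays] cannot hold, so this case is settled by
   direct computation: nothing is printed. *)
have [n_eq0|n_gt0] := posnP n.
  exists set0; split; last by rewrite cards0.
  - have -> : vset_code (set0 : {set T}) = [::].
      by apply: size0nil; rewrite size_map -cardE.
    by move: prints; rewrite /s0 n_eq0.
  - apply: strict_majority_dynamoP => X /set0Pn[x _].
    by have := rank_lt x; rewrite -/n n_eq0.
have E_asym u v : E u v -> ~~ E v u.
  move=> /[dup] /rank_rel_lt/andP[/rank_surj[x <-] /rank_surj[y <-]].
  by rewrite /E !rank_relE; apply: e_asym.
have E_in v : v < n -> exists u, E u v.
  case/rank_surj=> y <-; have := e_in y; rewrite /indeg card_gt0.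
  by case/set0Pn=> x; rewrite inE => exy; exists (rank x); rewrite /E rank_relE.
have [f [c [fC c12 outE le]]] := @run_main n E (@rank_rel_lt T e) E_asym E_in
  n_gt0 (Store (upd (fun=> 0) 0 n) (fun _ _ => 0) (adjacency n E 0 n) [::])
  erefl erefl erefl (fun _ _ => erefl).
exists [set u | f (rank u) == c]; split.
- suff -> : vset_code [set u : T | f (rank u) == c] =
            [seq nat_of_bool (f u == c) | u <- iota 0 n] by rewrite -outE.
  by rewrite /n map_iota_rank /vset_code; apply: eq_map => u; rewrite inE.
- exact: valid_dynamo.
- by rewrite -(count_rank T (fun u => f u == c)).
Qed.
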